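(* For a Banach algebra $\mathcal{A}$ with identity $I$ and elements $x,y\in\mathcal{A}$, consider the following assertions: (I) the Mercator series $\sum_{n=1}^\infty L_n(x,y)$, where $L_n(x,y)=\frac{(-1)^{n+1}}{n}(e^xe^y-I)^n$, is convergent in $\mathcal{A}$; (II) the BCH series $\sum_{n=1}^\infty Z_n(x,y)$ is convergent in $\mathcal{A}$; (III) there exists a logarithm of $e^xe^y$, i.e., some $V\in\mathcal{A}$ with $e^V=e^xe^y$; (IV) the sums of the Mercator series and of the BCH series are equal. Then the following facts hold: 1. (II) is sufficient for (III) (for all $\mathcal{A}$ and all $x,y\in\mathcal{A}$), but not necessary: there exist a Banach algebra $\mathcal{A}$ and $x,y\in\mathcal{A}$ for which (III) is true and (II) is false. 2. (I) is sufficient for (III) (for all $\mathcal{A}$ and all $x,y\in\mathcal{A}$), but not necessary: there exist $\mathcal{A}$ and $x,y\in\mathcal{A}$ for which (III) is true and (I) is false. 3. (I) and (II) are independent of each other: there exist $\mathcal{A}$ and $x,y\in\mathcal{A}$ for which (I) is true and (II) is false, and there exist $\mathcal{A}$ and $x,y\in\mathcal{A}$ for which (II) is true and (I) is false. 4. (I), (II), (III) may all be false: there exist $\mathcal{A}$ and $x,y\in\mathcal{A}$ for which (I), (II) and (III) are all false. 5. (I) and (II) may hold true while (IV) is false: there exist $\mathcal{A}$ and $x,y\in\mathcal{A}$ for which both series converge but their sums are different.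
   Context: A Banach algebra is a unital associative algebra over $\mathbb{R}$ or $\mathbb{C}$ (identity denoted $I$) that is a Banach space with $\|xy\|\le\|x\|\,\|y\|$ for all $x,y$. The bracket is $[x,y]=xy-yx$. The exponential is $e^W=\sum_{k=0}^\infty W^k/k!$. Convergence of a series means convergence in norm of its partial sums (in the given order); absolute convergence is not required. The BCH series of $x,y$ is the (homogeneous) series $\sum_{n=1}^\infty Z_n(x,y)$, where $Z_n(x,y)$ is the homogeneous Lie polynomial of degree $n$ $$Z_n(x,y)=\frac1n\sum_{k=1}^n\frac{(-1)^{k+1}}{k}\sum_{\substack{(i_1,j_1),\ldots,(i_k,j_k)\neq(0,0)\\ i_1+j_1+\cdots+i_k+j_k=n}}\frac{(\mathrm{ad}\,x)^{i_1}(\mathrm{ad}\,y)^{j_1}\cdots(\mathrm{ad}\,x)^{i_k}(\mathrm{ad}\,y)^{j_k-1}(y)}{i_1!\,j_1!\cdots i_k!\,j_k!},$$ with $i_r,j_r$ nonnegative integers and $(\mathrm{ad}\,a)(b)=[a,b]$; when $j_k=0$ (so $i_k\ne0$) the summand is understood to end with $(\mathrm{ad}\,x)^{i_k-1}(x)$. Equivalently, $Z_n(x,y)$ is the homogeneous component of degree $n$ of $\ln(e^xe^y)$ in the algebra of formal power series over $\mathbb{Q}$ in two non-commuting indeterminates, i.e. $$Z_n(x,y)=\sum_{k=1}^n\frac{(-1)^{k+1}}{k}\sum_{\substack{(i_1,j_1),\ldots,(i_k,j_k)\neq(0,0)\\ i_1+j_1+\cdots+i_k+j_k=n}}\frac{x^{i_1}y^{j_1}\cdots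 x^{i_k}y^{j_k}}{i_1!\,j_1!\cdots i_k!\,j_k!}.$$ For instance $Z_1(x,y)=x+y$, $Z_2(x,y)=\tfrac12[x,y]$. *)

(* Defs.v *)
From HB Require Import structures.
From mathcomp Require Import all_boot all_order all_algebra.
From mathcomp Require Import all_classical all_reals all_analysis.
From mathcomp Require Import complex.

Set Implicit Arguments.
Unset Strict Implicit.
Unset Printing Implicit Defensive.

Import Order.TTheory GRing.Theory Num.Theory.
Import numFieldNormedType.Exports.

Local Open Scope ring_scope.
Local Open Scope classical_set_scope.

(* Hierarchy-Builder rejects a common structure of rings and normed modules
   declared after Num.NumDomain, which already inherits from both.  Hence this
   record, whose carrier then receives the ring operations.
   The zero algebra is allowed and the norm of the identity is not normalized.
   Norms take their values in K; for K = R[i] they are nonnegative for the order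
   of R[i], i.e. real and nonnegative. *)
Record banachAlgType (K : numFieldType) := BanachAlgebra {
  banach_space : completeNormedModType K;
  banach_one : banach_space;
  banach_mul : banach_space -> banach_space -> banach_space;
  banach_mulA : associative banach_mul;
  banach_mul1l : left_id banach_one banach_mul;
  banach_mul1r : right_id banach_one banach_mul;
  banach_mulDl : left_distributive banach_mul +%R;
  banach_mulDr : right_distributive banach_mul +%R;
  banach_scaleAl : forall (a : K) (x y : banach_space),
    a *: banach_mul x y = banach_mul (a *: x) y;
  banach_scaleAr : forall (a : K) (x y : banach_space),
    a *: banach_mul x y = banach_mul x (a *: y);
  banach_norm_mul : forall x y : banach_space,
    `|banach_mul x y| <= `|x| * `|y|
}.

Definition banach_sort (K : numFieldType) (A : banachAlgType K) : Type :=
  banach_space A.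

Coercion banach_sort : banachAlgType >-> Sortclass.

HB.instance Definition _ (K : numFieldType) (A : banachAlgType K) :=
  CompleteNormedModule.copy (banach_sort A) (banach_space A).

HB.instance Definition _ (K : numFieldType) (A : banachAlgType K) :=
  GRing.Zmodule_isPzRing.Build (banach_sort A) (@banach_mulA K A)
    (@banach_mul1l K A) (@banach_mul1r K A) (@banach_mulDl K A)
    (@banach_mulDr K A).

Variant scalars := RealScalars | ComplexScalars.

Definition scalar_field (R : realType) (s : scalars) : numFieldType :=
  match s with
  | RealScalars => R
  | ComplexScalars => complex R
  end.

Section BanachAlgebraSeries.
Context {K : numFieldType} {A : banachAlgType K}.
Implicit Types x y : A.

Definition bexp x : A :=
  limn (series (fun k => (k`!%:R)^-1 *: x ^+ k : A)).

Definition ad x y : A := x * y - y * x.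

(* For s = [:: (i_1, j_1); ...; (i_k, j_k)], this is
   (ad x)^i_1 (ad y)^j_1 ... (ad x)^i_k (ad y)^(j_k - 1) (y),
   ending with (ad x)^(i_k - 1) (x) when j_k = 0.  Only nonempty s without
   the pair (0, 0) are meaningful. *)
Fixpoint lie_monomial x y (s : seq (nat * nat)) : A :=
  match s with
  | [::] => 0
  | [:: (i, j)] =>
      if j is j'.+1 then iter i (ad x) (iter j' (ad y) y)
      else iter i.-1 (ad x) x
  | (i, j) :: s' => iter i (ad x) (iter j (ad y) (lie_monomial x y s'))
  end.

(* Z_n(x, y) for n >= 1.  Exponents range over 'I_n.+1 without loss, since they
   add up to n. *)
Definition bch_term x y (n : nat) : A :=
  n%:R^-1 *: \sum_(1 <= k < n.+1) ((-1) ^+ k.+1 / k%:R) *: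
    \sum_(f : {ffun 'I_k -> 'I_n.+1 * 'I_n.+1} |
          [forall r, ((f r).1 : nat, (f r).2 : nat) != (0, 0)%N] &&
          (\sum_r ((f r).1 + (f r).2) == n)%N)
      ((\prod_r ((f r).1`! * (f r).2`!))%N%:R)^-1 *:
        lie_monomial x y
          [seq ((f r).1 : nat, (f r).2 : nat) | r <- enum 'I_k].

(* L_n(x, y) for n >= 1. *)
Definition mercator_term x y (n : nat) : A :=
  ((-1) ^+ n.+1 / n%:R) *: (bexp x * bexp y - 1) ^+ n.

(* series u is the sequence of the sums \sum_(0 <= k < n) u k, hence the shift
   for series that start at 1. *)
Definition mercator_series x y : A^nat :=
  series (fun n => mercator_term x y n.+1).

Definition bch_series x y : A^nat := series (fun n => bch_term x y n.+1).

Definition mercator_converges x y : Prop := cvgn (mercator_series x y).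

Definition bch_converges x y : Prop := cvgn (bch_series x y).

Definition product_has_log x y : Prop :=
  exists V : A, bexp V = bexp x * bexp y.

(* Meaningful only when both series converge. *)
Definition equal_sums x y : Prop :=
  limn (mercator_series x y) = limn (bch_series x y).

End BanachAlgebraSeries.

(* Main.v *)
(* For (II) => (III), let V be the sum of the BCH series. The partial sums of
   sum Z_n t^n, for t < 1 close to 1, approximate V (Abel), while their
   exponentials approximate e^(tx) e^(ty): both are polynomials in t whose
   coefficients agree up to the degree of truncation, and the remaining
   coefficients have a geometric majorant. Hence e^V = e^x e^y. The same argument
   applied to log(1 + w t) gives (I) => (III).

   That exp(sum Z_n t^n) = e^(tx) e^(ty) holds formally for the Lie polynomials
   Z_n is seen by adjoining the Euler operator D = t d/dt to the truncated power
   series. With X = tx, Y = ty and Z = log(e^X e^Y) one has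
   ad Z = log(e^(ad X) e^(ad Y)), and evaluating at D, where [D, X] = X and
   [D, Y] = Y, turns - ad Z (D) = [D, Z] = sum n Z_n t^n into Dynkin's formula.

   All counterexamples live in one real algebra of dimension 4, generated by i
   and e with i^2 = -1, e^2 = 0 and i e = - e i.
   - x = 2 pi i, y = e: here e^x e^y = 1 + e, so (I) holds. If the BCH series had a
     sum V, then V = 2 pi i + z e with V^2 = - 4 pi^2, so that e^V = 1, which is
     impossible.
   - x = pi i, y = e: here e^x e^y = - (1 + e). A logarithm V commutes with e, so
     its complex part is real and that of e^V is positive, which is impossible.
   - x = 2 pi i, y = 0: the sums are 0 and 2 pi i.
   - x = 2, y = 0: the Mercator series is that of e^2 - 1 > 1, and diverges. *)
Require Import Defs.
From HB Require Import structures.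
From mathcomp Require Import all_boot all_order all_algebra.
From mathcomp Require Import all_classical all_reals all_analysis.
From mathcomp Require Import complex ring lra zify.
Set Implicit Arguments.
Unset Strict Implicit.
Unset Printing Implicit Defensive.
Import Order.TTheory GRing.Theory Num.Theory.
Import numFieldNormedType.Exports.
Local Open Scope ring_scope.
Local Open Scope classical_set_scope.

(** * Truncated exponential and logarithm *)

Section TruncatedExpLog.
Context {K : numFieldType}.
Implicit Types (p q : {poly K}) (n N : nat).

Definition exp_poly N : {poly K} := \poly_(k < N.+1) (k`!%:R^-1).

(** The constant coefficient is a division by [0], hence [0], as a logarithm of [1 + 'X]
    requires. *)
Definition log_poly N : {poly K} := \poly_(k < N.+1) ((-1) ^+ k.+1 / k%:R).

Lemma exp_polyS N :
  exp_poly N.+1 = exp_poly N + ((N.+1)`!%:R^-1) *: 'X^(N.+1).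
Proof. by rewrite /exp_poly !poly_def big_ord_recr. Qed.

Lemma log_polyS N :
  log_poly N.+1 = log_poly N + ((-1) ^+ N.+2 / N.+1%:R) *: 'X^(N.+1).
Proof. by rewrite /log_poly !poly_def big_ord_recr. Qed.

Lemma deriv_exp_poly N : deriv (exp_poly N.+1) = exp_poly N.
Proof.
apply/polyP => i; rewrite coef_deriv !coef_poly ltnS; case: ltnP => _; last by rewrite mul0rn.
by rewrite factS natrM invfM -mulrnAl -[_^-1 *+ _]mulr_natr mulVf ?mul1r// pnatr_eq0.
Qed.

(** The derivative is a finite geometric sum of ratio [- 'X]. *)
Lemma deriv_log_poly N :
  deriv (log_poly N) * (1 + 'X) = 1 - (- 'X) ^+ N.
Proof.
elim: N => [|N IH].
  by rewrite /log_poly poly_def big_ord1 invr0 mulr0 scale0r raddf0 mul0r expr0 subrr.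
rewrite log_polyS derivD mulrDl IH derivZ derivXn -['X^_ *+ _]scaler_nat scalerA.
rewrite divfK ?pnatr_eq0//= exprS mulN1r exprS mulN1r opprK.
rewrite -mul_polyC rmorphXn rmorphN1 exprS -[(- 'X)]mulN1r !exprMn.
by ring.
Qed.

Lemma coef0_exp_poly N : (exp_poly N)`_0 = 1.
Proof. by rewrite coef_poly invr1. Qed.

Lemma coef0_log_poly N : (log_poly N)`_0 = 0.
Proof. by rewrite coef_poly invr0 mulr0. Qed.

Lemma dvdXn_coefP N p :
  reflect (forall i, (i < N)%N -> p`_i = 0) ('X^N %| p).
Proof.
apply: (iffP idP) => [/dvdpP[q ->] i iN|p0]; first by rewrite coefMXn iN.
apply/dvdpP; exists (drop_poly N p).
rewrite -[LHS](poly_take_drop N); rewrite (_ : take_poly N p = 0) ?add0r//.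
by apply/polyP => i; rewrite coef_take_poly coef0; case: ltnP => // /p0.
Qed.

Lemma dvdXn_deriv N p : p`_0 = 0 -> 'X^N %| deriv p -> 'X^(N.+1) %| p.
Proof.
move=> p0 /dvdXn_coefP dp; apply/dvdXn_coefP => -[//|i] iN.
have := dp i iN; rewrite coef_deriv => /eqP.
by rewrite -mulr_natr mulf_eq0 pnatr_eq0 orbF => /eqP.
Qed.

Lemma coef0_comp p q : q`_0 = 0 -> (p \Po q)`_0 = p`_0.
Proof. by move=> q0; rewrite -!horner_coef0 horner_comp (horner_coef0 q) q0. Qed.

Lemma dvdXn_exp N q : q`_0 = 0 -> 'X^N %| q ^+ N.
Proof.
move=> q0; apply: dvdp_exp2r; rewrite -['X]expr1; apply/dvdXn_coefP => i.
by rewrite ltnS leqn0 => /eqP ->.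
Qed.

(** With [U] the truncation of e^X - 1, the derivative of log(1 + U) - X, multiplied by [1 + U],
    consists of multiples of ['X^N]. The factor [1 + U] is coprime to ['X], so it can be cancelled,
    and integration gains one more degree. *)
Lemma log_exp_poly N : 'X^(N.+1) %| log_poly N \Po (exp_poly N - 1) - 'X.
Proof.
case: N => [|n].
  apply/dvdXn_coefP => -[|//] _.
  rewrite coefB coefX coef0_comp ?coef0_log_poly ?subrr//.
  by rewrite coefB coef0_exp_poly coefC subrr.
set U := exp_poly n.+1 - 1; set P := log_poly n.+1 \Po U.
have U0 : U`_0 = 0 by rewrite coefB coef0_exp_poly coefC subrr.
apply: dvdXn_deriv.
  by rewrite coefB coefX coef0_comp// coef0_log_poly subrr.
have co : coprimep ('X^(n.+1)) (1 + U).
  apply: coprimep_expl; rewrite coprimep_sym -['X]subr0 -polyC0 coprimep_XsubC.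
  by rewrite rootE horner_coef0 coefD coefC U0 addr0 oner_eq0.
rewrite -(Gauss_dvdpl _ co).
have -> : deriv (P - 'X) * (1 + U) =
    - (- U) ^+ n.+1 * deriv U - (n.+1)`!%:R^-1 *: 'X^(n.+1).
  rewrite derivB derivX mulrBl /P deriv_comp mul1r mulrAC.
  have -> : 1 + U = (1 + 'X) \Po U by rewrite comp_polyD comp_polyX comp_polyC.
  rewrite -comp_polyM deriv_log_poly comp_polyB comp_polyC rmorphXn /= comp_polyD.
  rewrite comp_polyC (_ : - 'X \Po U = - U); last by rewrite raddfN/= comp_polyX.
  rewrite comp_polyX {2}/U [X in 1 + (X - 1)]exp_polyS /U derivB derivC subr0.
  by rewrite deriv_exp_poly; ring.
apply: dvdp_sub; last by rewrite -mul_polyC dvdp_mull.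
by rewrite dvdp_mulr// dvdpNr dvdXn_exp// coefN U0 oppr0.
Qed.

(** The composite [Q] satisfies the differential equation Q' (1 + X) = Q up to the truncation. On
    coefficients this reads (i + 1) Q_(i+1) = (1 - i) Q_i with Q_0 = 1, a recurrence that only 1 + X
    satisfies. *)
Lemma exp_log_poly N : 'X^(N.+1) %| exp_poly N \Po log_poly N - (1 + 'X).
Proof.
case: N => [|n].
  apply/dvdXn_coefP => -[|//] _.
  by rewrite coefB coef0_comp ?coef0_log_poly// coef0_exp_poly coefD coefX coefC addr0 subrr.
set l := log_poly n.+1; set Q := exp_poly n.+1 \Po l.
have l0 : l`_0 = 0 by exact: coef0_log_poly.
have Q0 : Q`_0 = 1 by rewrite /Q coef0_comp// coef0_exp_poly.
have : 'X^(n.+1) %| deriv Q * (1 + 'X) - Q.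
  have -> : deriv Q * (1 + 'X) - Q =
      - (- 'X) ^+ n.+1 * (exp_poly n \Po l) - (n.+1)`!%:R^-1 *: l ^+ n.+1.
    rewrite /Q deriv_comp deriv_exp_poly -mulrA deriv_log_poly.
    rewrite [in X in _ - X]exp_polyS comp_polyD comp_polyZ rmorphXn /= comp_polyX; ring.
  apply: dvdp_sub; last by rewrite -mul_polyC dvdp_mull// dvdXn_exp.
  by rewrite dvdp_mulr// dvdpNr dvdXn_exp// coefN coefX oppr0.
move=> /dvdXn_coefP QE.
have rec i : (i < n.+1)%N -> Q`_i.+1 *+ i.+1 = Q`_i - Q`_i *+ i.
  move=> ilt; have /eqP := QE i ilt.
  rewrite mulrDr mulr1 coefB coefD coefMX !coef_deriv subr_eq0 => /eqP {1}<-.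
  by case: i {ilt} => [|i] /=; rewrite ?mulr0n ?subr0 ?addr0// addrK.
apply/dvdXn_coefP => i; rewrite coefB coefD coefX coefC.
elim: i => [|i IH] ilt; first by rewrite Q0 addr0 subrr.
have := rec i ilt; have := IH (ltnW ilt).
have nz : i.+1%:R != 0 :> K by rewrite pnatr_eq0.
case: i nz {IH ilt} => [|i] nz /=.
  by rewrite addr0 => /eqP; rewrite subr_eq0 => /eqP -> ; rewrite mulr1n mulr0n => ->; ring.
rewrite add0r eqSS; case: i nz => [|i] nz /=.
  move=> /eqP; rewrite subr_eq0 => /eqP ->; rewrite mulr1n subrr => /eqP.
  by rewrite mulrn_eq0 => /eqP ->; rewrite ?mulr0n ?mulr1n; ring.
rewrite subr0 => ->; rewrite mul0rn subr0 => /eqP.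
by rewrite mulrn_eq0 => /eqP ->; rewrite ?mulr0n; ring.
Qed.

End TruncatedExpLog.

Section BigSums.
Context {V : nmodType}.

Lemma sum_triangle N (G : nat -> nat -> V) :
  \sum_(n < N.+1) \sum_(j < n.+1) G (n - j)%N j =
  \sum_(i < N.+1) \sum_(j < N.+1 | (i + j <= N)%N) G i j.
Proof.
transitivity (\sum_(n < N.+1) \sum_(j < N.+1 | (j <= n)%N) G (n - j)%N j).
  by apply: eq_bigr => n _; rewrite (big_ord_widen _ (fun j => G (n - j)%N j) (ltn_ord n)).
rewrite (exchange_big_dep xpredT)//= [RHS](exchange_big_dep xpredT)//=.
apply: eq_bigr => j _.
rewrite -(big_geq_mkord j N.+1 xpredT (fun n => G (n - j)%N j)).
rewrite -{1}[j : nat]add0n big_addn big_mkord.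
rewrite (big_ord_widen _ (fun i => G (i + j - j)%N j) (leq_subr j N.+1)).
apply: eq_big => [i|i _]; last by rewrite addnK.
by rewrite /=; lia.
Qed.

End BigSums.

Section TruncatedExpLogAlgebra.
Context {K : numFieldType} {A : algType K}.
Implicit Types (a b w : A) (N : nat).

Definition texp N a : A := \sum_(k < N.+1) k`!%:R^-1 *: a ^+ k.

Definition tlog N w : A := \sum_(k < N.+1) ((-1) ^+ k.+1 / k%:R) *: w ^+ k.

Lemma horner_alg_poly n (E : nat -> K) a :
  horner_alg a (\poly_(i < n) E i) = \sum_(i < n) E i *: a ^+ i.
Proof.
rewrite poly_def linear_sum; apply: eq_bigr => i _.
by rewrite linearZ /= mulr_algl rmorphXn /= horner_algX.
Qed.

Lemma horner_alg_comp a p q :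
  horner_alg a (p \Po q) = horner_alg (horner_alg a q) p.
Proof.
rewrite comp_polyE linear_sum /= -[in RHS](coefK p) horner_alg_poly.
by apply: eq_bigr => i _; rewrite linearZ /= ?mulr_algl rmorphXn.
Qed.

Lemma horner_alg_dvdXn N a (p q : {poly K}) :
  a ^+ N = 0 -> 'X^N %| p - q -> horner_alg a p = horner_alg a q.
Proof.
move=> aN /dvdpP[r pq]; apply/eqP; rewrite -subr_eq0 -rmorphB /= pq rmorphM /=.
by rewrite rmorphXn /= horner_algX aN mulr0.
Qed.

Lemma texpE N a : texp N a = horner_alg a (exp_poly N).
Proof. by rewrite horner_alg_poly. Qed.

Lemma tlogE N a : tlog N a = horner_alg a (log_poly N).
Proof. by rewrite horner_alg_poly. Qed.

(** Evaluation at a nilpotent element kills the multiples of ['X^(N.+1)], which turns the congruence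
    of polynomials into an equality. *)
Lemma texp_tlog N w : w ^+ N.+1 = 0 -> texp N (tlog N w) = 1 + w.
Proof.
move=> wN; rewrite texpE tlogE -horner_alg_comp.
rewrite (horner_alg_dvdXn wN (exp_log_poly N)) rmorphD /= horner_algX.
by rewrite rmorph1.
Qed.

Lemma tlog_texp N a : a ^+ N.+1 = 0 -> tlog N (texp N a - 1) = a.
Proof.
move=> aN; rewrite tlogE texpE -[1](rmorph1 (horner_alg a)) -rmorphB -horner_alg_comp.
by rewrite (horner_alg_dvdXn aN (log_exp_poly N)) horner_algX.
Qed.

Lemma texp0 N : texp N 0 = 1 :> A.
Proof.
rewrite /texp big_ord_recl expr0 invr1 scale1r big1 ?addr0// => i _.
by rewrite expr0n scaler0.
Qed.

Lemma texp_diag a b n : GRing.comm a b ->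
  n`!%:R^-1 *: (a + b) ^+ n =
  \sum_(j < n.+1) (((n - j)`! * j`!)%N%:R^-1 *: (a ^+ (n - j) * b ^+ j)).
Proof.
move=> ab; rewrite exprDn_comm// scaler_sumr; apply: eq_bigr => j _.
rewrite -[(a ^+ _ * _) *+ _]scaler_nat scalerA; congr (_ *: _).
have jn : (j <= n)%N by rewrite -ltnS.
rewrite -(bin_fact jn) [(j`! * _)%N]mulnC natrM invfM mulrAC mulVf ?mul1r//.
by rewrite pnatr_eq0 -lt0n bin_gt0.
Qed.

(** The binomial theorem gives the products with [i + j <= N] only; the others vanish, so the
    triangle of indices may be completed to a square. *)
Lemma texpD N a b : GRing.comm a b ->
  (forall i j, (N < i + j)%N -> a ^+ i * b ^+ j = 0) ->
  texp N (a + b) = texp N a * texp N b.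
Proof.
move=> ab ab0; rewrite /texp mulr_suml.
under eq_bigr do rewrite (texp_diag _ ab).
rewrite (sum_triangle _ (fun i j => (i`! * j`!)%N%:R^-1 *: (a ^+ i * b ^+ j))).
apply: eq_bigr => i _; rewrite mulr_sumr big_mkcond; apply: eq_bigr => j _ /=.
rewrite natrM invfM -scalerA -scalerAl -scalerAr.
by case: leqP => // /ab0 ->; rewrite !scaler0.
Qed.

End TruncatedExpLogAlgebra.

(** * Endomorphisms of filtered modules *)

(* The endomorphisms of a module with a separated filtration of length [N] form
   again such a module, so that the construction can be iterated: the formal
   variables live in [flend V], their adjoint actions in [flend (flend V)]. *)
Record filtMod (K : numFieldType) (N : nat) := FiltMod {
  filt_sort :> lmodType K;
  fil : nat -> filt_sort -> Prop;
  fil0 : forall d, fil d 0;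
  fil_lin : forall d c u v, fil d u -> fil d v -> fil d (c *: u + v);
  fil_all : forall v, fil 0 v;
  fil_sep : forall d v, (N < d)%N -> fil d v -> v = 0;
  fil_nz : exists v : filt_sort, v != 0
}.

Section FilteredEndomorphisms.
Context {K : numFieldType} {N : nat} (V : filtMod K N).

Record flend := Flend {
  flend_fun :> V -> V;
  flend_lin : forall c u v, flend_fun (c *: u + v) = c *: flend_fun u + flend_fun v;
  flend_fil : forall d v, fil d v -> fil d (flend_fun v)
}.
Implicit Types f g h : flend.

Lemma flendP f g : (forall v, f v = g v) -> f = g.
Proof.
case: f g => [f lf ff] [g lg fg] /= fgE.
have {fgE}fgE : f = g by apply/funext.
by subst g; congr Flend; exact: Prop_irrelevance.
Qed.

HB.instance Definition _ := gen_eqMixin flend.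
HB.instance Definition _ := gen_choiceMixin flend.

Lemma flendD f u v : f (u + v) = f u + f v.
Proof. by rewrite -[u]scale1r flend_lin !scale1r. Qed.

Lemma flend_at0 f : f 0 = 0.
Proof. by apply: (addrI (f 0)); rewrite -flendD !addr0. Qed.

Lemma flendZ f c u : f (c *: u) = c *: f u.
Proof. by rewrite -[c *: u]addr0 flend_lin flend_at0 addr0. Qed.

Fact fl_zero_lin c (u v : V) : (0 : V) = c *: 0 + 0.
Proof. by rewrite scaler0 addr0. Qed.
Definition fl_zero : flend :=
  @Flend (fun=> 0) fl_zero_lin (fun d _ _ => fil0 V d).

(** Sum, scaling and opposite are all instances of one linear combination, so linearity and
    compatibility with the filtration are checked once. *)
Fact fl_comb_lin a f g c u v :
  a *: f (c *: u + v) + g (c *: u + v) =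
  c *: (a *: f u + g u) + (a *: f v + g v).
Proof. by rewrite !flend_lin !scalerDr !scalerA mulrC addrACA. Qed.
Fact fl_comb_fil a f g d v : fil d v -> fil d (a *: f v + g v).
Proof. by move=> dv; apply: fil_lin; exact: flend_fil. Qed.
Definition fl_comb a f g : flend :=
  Flend (fl_comb_lin a f g) (@fl_comb_fil a f g).

Definition fl_add f g : flend := fl_comb 1 f g.
Definition fl_scale c f : flend := fl_comb c f fl_zero.
Definition fl_opp f : flend := fl_scale (- 1) f.

Definition fl_one : flend :=
  @Flend id (fun _ _ _ => erefl) (fun _ _ dv => dv).

Fact fl_mul_lin f g c u v : f (g (c *: u + v)) = c *: f (g u) + f (g v).
Proof. by rewrite !flend_lin. Qed.
Fact fl_mul_fil f g d v : fil d v -> fil d (f (g v)).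
Proof. by move=> dv; do 2 apply: flend_fil. Qed.
Definition fl_mul f g : flend :=
  Flend (fl_mul_lin f g) (@fl_mul_fil f g).

Fact fl_addA : associative fl_add.
Proof. by move=> f g h; apply: flendP => v /=; rewrite !scale1r addrA. Qed.
Fact fl_addC : commutative fl_add.
Proof. by move=> f g; apply: flendP => v /=; rewrite !scale1r addrC. Qed.
Fact fl_add0 : left_id fl_zero fl_add.
Proof. by move=> f; apply: flendP => v /=; rewrite scaler0 add0r. Qed.
Fact fl_addN : left_inverse fl_zero fl_opp fl_add.
Proof.
by move=> f; apply: flendP => v /=; rewrite scale1r addr0 scaleN1r addNr.
Qed.

HB.instance Definition _ := GRing.isZmodule.Build flend
  fl_addA fl_addC fl_add0 fl_addN.

Fact fl_mulA : associative fl_mul. Proof. by move=> f g h; apply: flendP. Qed.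
Fact fl_mul1l : left_id fl_one fl_mul. Proof. by move=> f; apply: flendP. Qed.
Fact fl_mul1r : right_id fl_one fl_mul. Proof. by move=> f; apply: flendP. Qed.
Fact fl_mulDl : left_distributive fl_mul +%R.
Proof. by move=> f g h; apply: flendP. Qed.
Fact fl_mulDr : right_distributive fl_mul +%R.
Proof. by move=> f g h; apply: flendP => v /=; rewrite !scale1r flendD. Qed.
Fact fl_one_neq0 : fl_one != 0.
Proof.
have [v vn0] := fil_nz V; apply/eqP => /(congr1 (fun f : flend => f v)) /= v0.
by rewrite v0 eqxx in vn0.
Qed.

HB.instance Definition _ := GRing.Zmodule_isNzRing.Build flend
  fl_mulA fl_mul1l fl_mul1r fl_mulDl fl_mulDr fl_one_neq0.

Fact fl_scaleA a b f : fl_scale a (fl_scale b f) = fl_scale (a * b) f.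
Proof. by apply: flendP => v /=; rewrite !addr0 scalerA. Qed.
Fact fl_scale1 : left_id 1 fl_scale.
Proof. by move=> f; apply: flendP => v /=; rewrite addr0 scale1r. Qed.
Fact fl_scaleDr : right_distributive fl_scale +%R.
Proof.
by move=> a f g; apply: flendP => v /=; rewrite !addr0 !scale1r scalerDr.
Qed.
Fact fl_scaleDl f : {morph fl_scale^~ f : a b / a + b}.
Proof.
by move=> a b; apply: flendP => v /=; rewrite !addr0 !scale1r scalerDl.
Qed.

HB.instance Definition _ := GRing.Zmodule_isLmodule.Build K flend
  fl_scaleA fl_scale1 fl_scaleDr fl_scaleDl.

Lemma flend_mulE f g v : (f * g) v = f (g v). Proof. by []. Qed.
Lemma flend_0E v : (0 : flend) v = 0. Proof. by []. Qed.
Lemma flend_addE f g v : (f + g) v = f v + g v.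
Proof. by rewrite /= scale1r. Qed.
Lemma flend_scaleE c f v : (c *: f) v = c *: f v.
Proof. by rewrite /= addr0. Qed.
Lemma flend_oppE f v : (- f) v = - f v.
Proof. by rewrite -scaleN1r flend_scaleE scaleN1r. Qed.
Lemma flend_sumE (I : Type) (r : seq I) (P : pred I) (F : I -> flend) v :
  (\sum_(i <- r | P i) F i) v = \sum_(i <- r | P i) F i v.
Proof.
apply: (big_morph (fun f : flend => f v)) => // f g; exact: flend_addE.
Qed.

Fact fl_scaleAl (k : K) f g : k *: (f * g) = k *: f * g.
Proof. by apply: flendP => v; rewrite flend_scaleE !flend_mulE flend_scaleE. Qed.
HB.instance Definition _ := GRing.Lmodule_isLalgebra.Build K flend fl_scaleAl.

Fact fl_scaleAr (k : K) f g : k *: (f * g) = f * (k *: g).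
Proof.
by apply: flendP => v; rewrite flend_scaleE !flend_mulE flend_scaleE flendZ.
Qed.
HB.instance Definition _ := GRing.Lalgebra_isAlgebra.Build K flend fl_scaleAr.

(** The filtration that [flend V] inherits. Level [1] replaces divisibility by the formal variable
    and makes exponentials and logarithms finite sums. *)
Definition lev d f : Prop := forall e v, fil e v -> fil (e + d) (f v).

Fact lev0 d : lev d 0. Proof. by move=> e v _; exact: fil0. Qed.
Fact lev_lin d c f g : lev d f -> lev d g -> lev d (c *: f + g).
Proof.
move=> lf lg e v ev; rewrite flend_addE flend_scaleE.
by apply: fil_lin; [exact: lf|exact: lg].
Qed.
Fact lev_all f : lev 0 f.
Proof. by move=> e v ev; rewrite addn0; exact: flend_fil. Qed.
Fact lev_sep d f : (N < d)%N -> lev d f -> f = 0.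
Proof.
move=> Nd lf; apply: flendP => v; apply: (@fil_sep _ _ V d) => //.
exact: lf _ _ (fil_all v).
Qed.
Fact flend_nz : exists f : flend, f != 0.
Proof. by exists 1; exact: oner_neq0. Qed.

Definition flend_filt : filtMod K N :=
  @FiltMod K N flend lev lev0 lev_lin lev_all lev_sep flend_nz.

Lemma levM d e f g : lev d f -> lev e g -> lev (d + e) (f * g).
Proof.
by move=> lf lg c v cv; rewrite [(d + e)%N]addnC addnA; exact/lf/lg.
Qed.

Lemma levX d f : lev 1 f -> lev d (f ^+ d).
Proof.
move=> lf; elim: d => [|d IH]; first exact: lev_all.
by rewrite exprS -add1n; exact: levM.
Qed.

Lemma levZ d c f : lev d f -> lev d (c *: f).
Proof. by move=> lf; rewrite -[c *: f]addr0; exact: lev_lin (lev0 d). Qed.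

Lemma levB d f g : lev d f -> lev d g -> lev d (f - g).
Proof.
by move=> lf lg; rewrite addrC -scaleN1r; exact: lev_lin.
Qed.

Lemma lev_sum d (I : Type) (r : seq I) (P : pred I) (F : I -> flend) :
  (forall i, P i -> lev d (F i)) -> lev d (\sum_(i <- r | P i) F i).
Proof.
move=> FP; apply: big_ind => //; first exact: lev0.
by move=> f g lf lg; rewrite -[f]scale1r; exact: lev_lin.
Qed.

Lemma lev1_nilp f : lev 1 f -> f ^+ N.+1 = 0.
Proof. by move=> /(@levX N.+1); apply: lev_sep. Qed.

Lemma lev1_exp2 f g i j : lev 1 f -> lev 1 g -> (N < i + j)%N ->
  f ^+ i * g ^+ j = 0.
Proof. move=> lf lg ij; by apply: (lev_sep ij); apply: levM; apply: levX. Qed.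

Lemma lev1_texpD f g : lev 1 f -> lev 1 g -> GRing.comm f g ->
  texp N (f + g) = texp N f * texp N g.
Proof. by move=> lf lg fg; apply: texpD => // i j; exact: lev1_exp2. Qed.

Lemma lev1_sum (c : nat -> K) f :
  lev 1 f -> c 0%N = 0 -> lev 1 (\sum_(k < N.+1) c k *: f ^+ k).
Proof.
move=> lf c0; apply: lev_sum => -[[|k] kN] _ /=.
  by rewrite c0 scale0r; exact: lev0.
by apply: levZ; rewrite exprSr -[1%N]add0n; apply: levM => //; exact: lev_all.
Qed.

Lemma lev1_tlog f : lev 1 f -> lev 1 (tlog N f).
Proof.
move=> lf; apply: (@lev1_sum (fun k => (-1) ^+ k.+1 / k%:R)) => //.
by rewrite invr0 mulr0.
Qed.

Lemma lev1_texpB1 f : lev 1 f -> lev 1 (texp N f - 1).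
Proof.
move=> lf; rewrite /texp big_ord_recl expr0 invr1 scale1r addrC addKr.
apply: lev_sum => i _; apply: levZ; rewrite exprSr -[1%N]add0n.
by apply: levM => //; exact: lev_all.
Qed.

End FilteredEndomorphisms.
Arguments lev {K N V}.

(** * Adjoint actions, as endomorphisms of the algebra of endomorphisms *)

Section AdjointAction.
Context {K : numFieldType} {N : nat} (V : filtMod K N).
Local Notation B := (flend V).
Local Notation E := (flend (flend_filt V)).
Implicit Types (a b u : B).

Lemma flend2_scaleE (c : K) (f : E) u (v : V) : ((c *: f) u : B) v = c *: (f u : B) v.
Proof. by rewrite [(c *: f) u]flend_scaleE; exact: (flend_scaleE c (f u : B) v). Qed.

Fact opL_lin a c u v : a * (c *: u + v) = c *: (a * u) + a * v.
Proof. by rewrite mulrDr scalerAr. Qed.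
Fact opL_fil a d u : lev d u -> lev d (a * u).
Proof. by move=> du; rewrite -[d]add0n; apply: levM => //; exact: lev_all. Qed.
Definition opL a : E := @Flend K N (flend_filt V) ( *%R a) (opL_lin a) (@opL_fil a).

Fact opR_lin a c u v : (c *: u + v) * a = c *: (u * a) + v * a.
Proof. by rewrite mulrDl scalerAl. Qed.
Fact opR_fil a d u : lev d u -> lev d (u * a).
Proof. by move=> du; rewrite -[d]addn0; apply: levM => //; exact: lev_all. Qed.
Definition opR a : E :=
  @Flend K N (flend_filt V) (fun u => u * a) (opR_lin a) (@opR_fil a).

Definition opad a : E := opL a - opR a.

Lemma opLE a u : opL a u = a * u. Proof. by []. Qed.
Lemma opRE a u : opR a u = u * a. Proof. by []. Qed.

Lemma opadE a u : opad a u = a * u - u * a.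
Proof. by rewrite flend_addE flend_oppE. Qed.

Lemma opRN a : opR (- a) = - opR a.
Proof. by apply: flendP => u; rewrite flend_oppE !opRE mulrN. Qed.

Lemma opL_exp a k u : (opL a ^+ k) u = a ^+ k * u.
Proof.
elim: k u => [|k IH] u; first by rewrite !expr0 mul1r.
by rewrite !exprS flend_mulE IH opLE mulrA.
Qed.

Lemma opR_exp a k u : (opR a ^+ k) u = u * a ^+ k.
Proof.
elim: k u => [|k IH] u; first by rewrite !expr0 mulr1.
by rewrite exprS exprSr flend_mulE IH opRE mulrA.
Qed.

Lemma texp_opL a u : texp N (opL a) u = texp N a * u.
Proof.
rewrite /texp flend_sumE mulr_suml; apply: eq_bigr => k _.
by rewrite flend_scaleE opL_exp scalerAl.
Qed.

Lemma texp_opR a u : texp N (opR a) u = u * texp N a.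
Proof.
rewrite /texp flend_sumE mulr_sumr; apply: eq_bigr => k _.
by rewrite flend_scaleE opR_exp scalerAr.
Qed.

Lemma lev_opL d a : lev d a -> lev d (opL a).
Proof. by move=> da e u eu; rewrite addnC; exact: levM. Qed.
Lemma lev_opR d a : lev d a -> lev d (opR a).
Proof. by move=> da e u eu; exact: levM. Qed.
Lemma lev_opad d a : lev d a -> lev d (opad a).
Proof. by move=> da; apply: levB; [exact: lev_opL|exact: lev_opR]. Qed.

Lemma levN d a : lev d a -> lev d (- a).
Proof. by move=> da; rewrite -[- a]add0r; apply: levB => //; exact: lev0. Qed.

(** Left and right multiplications commute, so the exponential of [opL a - opR a] is a product; this
    is conjugation by e^a. *)
Lemma texp_opad a u : lev 1 a -> texp N (opad a) u = texp N a * u * texp N (- a).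
Proof.
move=> la; rewrite /opad -opRN lev1_texpD.
- by rewrite flend_mulE texp_opL texp_opR mulrA.
- exact: lev_opL.
- by apply: lev_opR; exact: levN.
- by apply: flendP => v; rewrite !flend_mulE !opLE !opRE mulrA.
Qed.

Lemma texpN a : lev 1 a -> texp N a * texp N (- a) = 1.
Proof.
move=> la; rewrite -lev1_texpD ?subrr ?texp0//; first exact: levN.
by rewrite /GRing.comm mulrN mulNr.
Qed.

Section Log.
Variables X Y : B.
Hypotheses (lX : lev 1 X) (lY : lev 1 Y).
Let F := texp N X * texp N Y.
Let Z := tlog N (F - 1).

Let lF : lev 1 (F - 1).
Proof.
have -> : F - 1 = 1 *: ((texp N X - 1) * texp N Y) + (texp N Y - 1).
  by rewrite scale1r mulrBl mul1r addrA subrK.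
apply: lev_lin; last exact: lev1_texpB1.
by rewrite -[1%N]addn0; apply: levM; [exact: lev1_texpB1|exact: lev_all].
Qed.

Let lZ : lev 1 Z. Proof. exact: lev1_tlog. Qed.

Lemma texp_log_prod : texp N Z = F.
Proof. by rewrite /Z texp_tlog ?lev1_nilp// addrC subrK. Qed.

(** Conjugation by [F] is the conjugation by e^Y followed by that by e^X. Hence e^(ad Z) = e^(ad X)
    e^(ad Y), and the logarithm can be taken because [opad Z] has level [1] and so is nilpotent. *)
Lemma opad_log_prod :
  opad Z = tlog N (texp N (opad X) * texp N (opad Y) - 1).
Proof.
(* The left side is a left inverse of [F], the right side a right inverse. *)
have FV : texp N (- Z) = texp N (- Y) * texp N (- X).
  rewrite -[LHS]mulr1 -[X in _ * X = _](_ : F * (texp N (- Y) * texp N (- X)) = 1).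
    rewrite mulrA -{1}texp_log_prod -{2}[Z]opprK texpN ?mul1r//; exact: levN.
  by rewrite /F -mulrA (mulrA (texp N Y)) texpN// mul1r texpN.
have -> : texp N (opad X) * texp N (opad Y) = texp N (opad Z).
  apply: flendP => u; rewrite flend_mulE !texp_opad// texp_log_prod FV /F.
  by rewrite !mulrA.
by rewrite tlog_texp//; apply: lev1_nilp; exact: lev_opad.
Qed.

Lemma lev1_log_prod : lev 1 Z. Proof. exact: lZ. Qed.

End Log.
End AdjointAction.

(** * Dynkin's formula *)

Lemma flendN (K : numFieldType) (N : nat) (V : filtMod K N) (f : flend V) v :
  f (- v) = - f v.
Proof. by rewrite -scaleN1r flendZ scaleN1r. Qed.

Section LieMonomials.
Context {B : pzRingType}.
Implicit Types x y : B.

(** [ad] and [lie_monomial] again, over a bare ring: the formal argument uses no norm. *)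
Definition rad x y : B := x * y - y * x.

Fixpoint rlie_monomial x y (s : seq (nat * nat)) : B :=
  match s with
  | [::] => 0
  | [:: (i, j)] =>
      if j is j'.+1 then iter i (rad x) (iter j' (rad y) y)
      else iter i.-1 (rad x) x
  | (i, j) :: s' => iter i (rad x) (iter j (rad y) (rlie_monomial x y s'))
  end.

End LieMonomials.

(** * Power series truncated after degree [N], and the Euler operator on them *)

Section TruncatedSeries.
Context {K : numFieldType} {A : algType K} (N : nat).
Local Notation T := {ffun 'I_N.+1 -> A}.
Implicit Types (u v : T) (p q : {poly A}).

Definition tseries_fil (d : nat) v : Prop :=
  forall i : 'I_N.+1, (i < d)%N -> v i = 0.

Fact tseries_fil0 d : tseries_fil d 0.
Proof. by move=> i _; rewrite ffunE. Qed.
Fact tseries_fil_lin d c u v :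
  tseries_fil d u -> tseries_fil d v -> tseries_fil d (c *: u + v).
Proof. by move=> du dv i id; rewrite !ffunE du// dv// scaler0 addr0. Qed.
Fact tseries_fil_all v : tseries_fil 0 v. Proof. by []. Qed.
Fact tseries_fil_sep d v : (N < d)%N -> tseries_fil d v -> v = 0.
Proof.
move=> Nd dv; apply/ffunP => i; rewrite ffunE dv//.
exact: leq_trans (ltn_ord i) Nd.
Qed.
Definition tone : T := [ffun i : 'I_N.+1 => (i == 0%N :> nat)%:R].
Fact tseries_nz : exists v : T, v != 0.
Proof.
exists tone; apply/eqP => /ffunP /(_ ord0); rewrite !ffunE /=.
by move/eqP; rewrite oner_eq0.
Qed.

Definition tseries : filtMod K N := @FiltMod K N T tseries_fil tseries_fil0
  tseries_fil_lin tseries_fil_all tseries_fil_sep tseries_nz.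

Lemma taddE u v i : (u + v) i = u i + v i. Proof. by rewrite ffunE. Qed.
Lemma tscaleE c v i : (c *: v) i = c *: v i. Proof. by rewrite ffunE. Qed.
Lemma toppE v i : (- v) i = - v i. Proof. by rewrite ffunE. Qed.
Lemma tzeroE i : (0 : T) i = 0. Proof. by rewrite ffunE. Qed.

Definition tpoly v : {poly A} := \poly_(i < N.+1) v (inord i).

Lemma tpolyE v (i : 'I_N.+1) : (tpoly v)`_i = v i.
Proof. by rewrite coef_poly ltn_ord inord_val. Qed.

Lemma tpoly_lin c u v i : (tpoly (c *: u + v))`_i = c *: (tpoly u)`_i + (tpoly v)`_i.
Proof. by rewrite !coef_poly; case: ifP => _; rewrite ?ffunE ?scaler0 ?addr0. Qed.

Definition tmul_fun p v : T := [ffun i : 'I_N.+1 => (p * tpoly v)`_i].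

Fact tmul_lin p c u v : tmul_fun p (c *: u + v) = c *: tmul_fun p u + tmul_fun p v.
Proof.
apply/ffunP => i; rewrite !ffunE !coefM scaler_sumr -big_split /=.
by apply: eq_bigr => j _; rewrite tpoly_lin mulrDr scalerAr.
Qed.
Lemma coef_mul_tpoly0 p d v (i : nat) :
  tseries_fil d v -> (i < d)%N -> (i < N.+1)%N -> (p * tpoly v)`_i = 0.
Proof.
move=> dv id iN; rewrite coefM big1// => j _.
have ijN : (i - j < N.+1)%N by rewrite (leq_ltn_trans (leq_subr _ _)).
rewrite -[(i - j)%N]/(nat_of_ord (Ordinal ijN)) tpolyE dv ?mulr0//=.
by rewrite (leq_ltn_trans (leq_subr _ _)).
Qed.
Fact tmul_fil p d v : tseries_fil d v -> tseries_fil d (tmul_fun p v).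
Proof. by move=> dv i id; rewrite ffunE (coef_mul_tpoly0 _ dv). Qed.

(** A series is represented by the multiplication by it, so that series and the Euler operator are
    elements of one algebra and have commutators. *)
Definition tmul p : flend tseries := @Flend K N tseries _ (tmul_lin p) (@tmul_fil p).

Lemma tmulE p v i : tmul p v i = (p * tpoly v)`_i.
Proof. by rewrite ffunE. Qed.

Lemma tmulM p q : tmul (p * q) = tmul p * tmul q.
Proof.
apply: flendP => v; apply/ffunP => i; rewrite flend_mulE !tmulE -mulrA.
rewrite coefM [RHS]coefM; apply: eq_bigr => j _; congr (_ * _).
have ijN : (i - j < N.+1)%N by rewrite (leq_ltn_trans (leq_subr _ _)).
by rewrite -[(i - j)%N]/(nat_of_ord (Ordinal ijN)) tpolyE tmulE.
Qed.

Lemma tmulD p q : tmul (p + q) = tmul p + tmul q.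
Proof.
by apply: flendP => v; apply/ffunP => i; rewrite flend_addE taddE !tmulE mulrDl coefD.
Qed.

Lemma tmulB p q : tmul (p - q) = tmul p - tmul q.
Proof. by apply/eqP; rewrite eq_sym subr_eq -tmulD subrK. Qed.

Lemma tmul1 : tmul 1 = 1.
Proof. by apply: flendP => v; apply/ffunP => i; rewrite tmulE mul1r tpolyE. Qed.

(** Polynomials over [A] are scaled by [A]; a scalar of [K] therefore enters as [c%:A]. *)
Lemma tmulZ c p : tmul (c%:A *: p) = c *: tmul p.
Proof.
apply: flendP => v; apply/ffunP => i; rewrite flend_scaleE tscaleE !tmulE.
by rewrite -scalerAl coefZ mulr_algl.
Qed.

Lemma tmul_sum (I : Type) (r : seq I) (P : pred I) (F : I -> {poly A}) :
  tmul (\sum_(i <- r | P i) F i) = \sum_(i <- r | P i) tmul (F i).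
Proof.
apply: (big_morph tmul tmulD).
by apply: flendP => v; apply/ffunP => i; rewrite flend_0E tzeroE tmulE mul0r coef0.
Qed.

Lemma tmulX p k : tmul (p ^+ k) = tmul p ^+ k.
Proof. by elim: k => [|k IH]; rewrite ?tmul1// !exprS tmulM IH. Qed.

(** Acting on the constant series [1] reads off the coefficients of the multiplier, which [tmul p]
    thus determines up to degree [N]. *)
Lemma tmul_tone p (i : 'I_N.+1) : tmul p tone i = p`_i.
Proof.
rewrite tmulE (_ : tpoly tone = 1) ?mulr1//.
apply/polyP => j; rewrite coef_poly coefC; case: ltnP => jN.
  by rewrite ffunE inordK//; case: j {jN}.
by case: j jN.
Qed.

Lemma eq_tmul p q : (forall i, (i <= N)%N -> p`_i = q`_i) -> tmul p = tmul q.
Proof.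
move=> pq; apply: flendP => v; apply/ffunP => i; rewrite !tmulE !coefM.
apply: eq_bigr => j _; rewrite pq//.
by rewrite -ltnS (leq_trans (ltn_ord j))// ltn_ord.
Qed.

Lemma lev_tmul p : p`_0 = 0 -> lev 1 (tmul p).
Proof.
move=> p0 e v ev i; rewrite addn1 ltnS tmulE => ie.
rewrite coefM big1// => -[[|j] ji] _ /=; first by rewrite p0 mul0r.
have ijN : (i - j.+1 < N.+1)%N by rewrite (leq_ltn_trans (leq_subr _ _)).
rewrite -[(i - _)%N]/(nat_of_ord (Ordinal ijN)) tpolyE ev ?mulr0//=.
by move: ie ji; lia.
Qed.

(* The Euler operator t d/dt, the derivation behind Dynkin's formula. *)
Fact teuler_lin c u v :
  [ffun i : 'I_N.+1 => (i : nat)%:R *: (c *: u + v) i] =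
  c *: [ffun i : 'I_N.+1 => (i : nat)%:R *: u i] + [ffun i : 'I_N.+1 => (i : nat)%:R *: v i] :> T.
Proof.
by apply/ffunP => i; rewrite !ffunE scalerDr !scalerA mulrC.
Qed.
Fact teuler_fil d v :
  tseries_fil d v -> tseries_fil d [ffun i : 'I_N.+1 => (i : nat)%:R *: v i].
Proof. by move=> dv i id; rewrite ffunE dv// scaler0. Qed.
Definition teuler : flend tseries :=
  @Flend K N tseries (fun v : T => [ffun i : 'I_N.+1 => (i : nat)%:R *: v i])
    teuler_lin teuler_fil.

(** The Leibniz rule: the term of index [j] in the coefficient of degree [i] acquires the factor (i
    - j) - i = - j. *)
Lemma opad_teuler p : opad (tmul p) teuler = - tmul (deriv p * 'X).
Proof.
rewrite opadE; apply/eqP; rewrite -addr_eq0; apply/eqP.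
apply: flendP => v; apply/ffunP => i.
rewrite !flend_addE flend_oppE !flend_mulE flend_0E !ffunE [X in _ - X + _]scaler_nat.
rewrite !coefM -sumrMnl -sumrB -big_split big1//= => j _.
have ijN : (i - j < N.+1)%N by rewrite (leq_ltn_trans (leq_subr _ _)).
rewrite -[(i - j)%N]/(nat_of_ord (Ordinal ijN)) !tpolyE ffunE /=.
rewrite coefMX coef_deriv scaler_nat mulrnAr.
have ji : (j <= i)%N by rewrite -ltnS.
rewrite -[X in X + _]opprB -mulrnBr ?leq_subr// subKn//.
move: (v _) => b; case: eqP => [->|/eqP]; first by rewrite mul0r mulr0n oppr0 addr0.
by rewrite -lt0n => j0; rewrite (prednK j0) mulrnAl addNr.
Qed.

End TruncatedSeries.
Arguments tseries {K} A N.
Arguments tmul {K A N}.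
Arguments teuler {K A N}.

Lemma enum_index_enum (T : finType) : enum T = index_enum T.
Proof. by rewrite -deprecated_filter_index_enum filter_predT. Qed.

Section Dynkin.
Context {K : numFieldType} {A : algType K}.
Implicit Types (x y c : A) (p q : {poly A}).

Definition rbch_term x y (n : nat) : A :=
  n%:R^-1 *: \sum_(1 <= k < n.+1) ((-1) ^+ k.+1 / k%:R) *:
    \sum_(f : {ffun 'I_k -> 'I_n.+1 * 'I_n.+1} |
          [forall r, ((f r).1 : nat, (f r).2 : nat) != (0, 0)%N] &&
          (\sum_r ((f r).1 + (f r).2) == n)%N)
      ((\prod_r ((f r).1`! * (f r).2`!))%N%:R)^-1 *:
        rlie_monomial x y
          [seq ((f r).1 : nat, (f r).2 : nat) | r <- enum 'I_k].

(** The homogeneous component of degree [n] of e^x e^y. *)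
Definition exp_prod_coef x y n : A :=
  \sum_(j < n.+1) (((n - j)`! * j`!)%N%:R^-1 *: (x ^+ (n - j) * y ^+ j)).

Definition degree (s : seq (nat * nat)) : nat := \sum_(p <- s) (p.1 + p.2).

Variables (x y : A) (N : nat).
Let X : flend (tseries A N) := tmul (x%:P * 'X).
Let Y : flend (tseries A N) := tmul (y%:P * 'X).
Let D : flend (tseries A N) := teuler.

Let lX : lev 1 X. Proof. by apply: lev_tmul; rewrite coefMX. Qed.
Let lY : lev 1 Y. Proof. by apply: lev_tmul; rewrite coefMX. Qed.

Lemma opad_mono c d a i :
  (opad (tmul (c%:P * 'X)) ^+ i) (tmul (a%:P * 'X^d)) =
  tmul ((iter i (rad c) a)%:P * 'X^(i + d)) :> flend (tseries A N).
Proof.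
elim: i => [|i IH]; first by rewrite expr0.
rewrite exprS flend_mulE IH opadE -!tmulM -tmulB; congr tmul; rewrite /= /rad.
rewrite polyCB !polyCM mulrBl addSn exprS.
rewrite -!mulrA; congr (_ * _ - _ * _).
  by rewrite !mulrA; congr (_ * _); rewrite commr_polyX.
by rewrite -[in RHS]exprS exprSr !mulrA; congr (_ * _); rewrite commr_polyXn.
Qed.

Lemma opad_euler c :
  opad (tmul (c%:P * 'X)) D = - tmul (c%:P * 'X) :> flend (tseries A N).
Proof.
rewrite opad_teuler; congr (- tmul (_ * _)).
by rewrite derivM derivC mul0r add0r derivX; exact: mulr1.
Qed.

(** The innermost bracket meets the Euler operator and returns minus the variable itself. This uses
    up one exponent, which explains the exponents [j_k - 1] and [i_k - 1] at the end of a Lie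
    monomial. *)
Lemma lie_word (s : seq (nat * nat)) : s != [::] -> all (predC1 (0, 0)%N) s ->
  (\prod_(p <- s) (opad X ^+ p.1 * opad Y ^+ p.2)) D =
  - tmul ((rlie_monomial x y s)%:P * 'X^(degree s)).
Proof.
rewrite /degree.
elim: s => [//|[i j] [|p s] IH] _.
  rewrite !big_seq1; case: j => [|j].
    case: i => [//|i] _; rewrite expr0 mulr1 exprSr flend_mulE opad_euler flendN.
    by rewrite -['X]expr1 opad_mono addn0 addn1.
  move=> _; rewrite exprSr mulrA !flend_mulE opad_euler !flendN.
  by rewrite -['X]expr1 !opad_mono addn1.
move=> /andP[_ sn0]; rewrite big_cons [X in 'X^X]big_cons !flend_mulE IH// !flendN.
by rewrite !opad_mono addnA.
Qed.

Lemma tlog_tmul p : exists q, tlog N (tmul p) = tmul q :> flend (tseries A N).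
Proof.
exists (\sum_(k < N.+1) (((-1) ^+ k.+1 / k%:R)%:A *: p ^+ k)).
by rewrite tmul_sum; apply: eq_bigr => k _; rewrite tmulZ tmulX.
Qed.

Lemma texp_tmulX c :
  texp N (tmul (c%:P * 'X)) = tmul (\poly_(k < N.+1) (k`!%:R^-1 *: c ^+ k))
  :> flend (tseries A N).
Proof.
rewrite poly_def tmul_sum; apply: eq_bigr => k _; rewrite -tmulX -tmulZ.
congr tmul; rewrite exprMn_comm; last exact: commr_polyX.
by rewrite -rmorphXn /= mul_polyC scalerA mulr_algl.
Qed.

Lemma texp_prod_coef n : (n <= N)%N ->
  ((\poly_(k < N.+1) (k`!%:R^-1 *: x ^+ k)) *
   (\poly_(k < N.+1) (k`!%:R^-1 *: y ^+ k)))`_n = exp_prod_coef x y n.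
Proof.
move=> nN; rewrite coefMr; apply: eq_bigr => j _.
have jn : (j <= n)%N by rewrite -ltnS.
rewrite !coef_poly !ltnS (leq_trans (leq_subr _ _) nN) (leq_trans jn nN).
by rewrite natrM invfM -scalerAl -scalerAr scalerA.
Qed.

(** Subtracting [1] removes the pair [(0, 0)]: hence the side condition on the exponents in Dynkin's
    formula. *)
Lemma texp_pairs :
  texp N (opad X) * texp N (opad Y) - 1 =
  \sum_(p : 'I_N.+1 * 'I_N.+1 | (p.1 : nat, p.2 : nat) != (0, 0)%N)
    (p.1`! * p.2`!)%N%:R^-1 *: (opad X ^+ p.1 * opad Y ^+ p.2).
Proof.
rewrite /texp big_distrlr /= pair_big /= (bigD1 (ord0, ord0))//=.
rewrite invr1 !expr0 !scale1r mulr1. rewrite [1 + _]addrC addrK.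
apply: eq_big => [p|p _]; last by rewrite natrM invfM -scalerAl -scalerAr scalerA.
by case: p => i j; rewrite !xpair_eqE -!val_eqE.
Qed.


Lemma texp_pairsX k :
  (texp N (opad X) * texp N (opad Y) - 1) ^+ k =
  \sum_(f : {ffun 'I_k -> 'I_N.+1 * 'I_N.+1} |
        [forall r, ((f r).1 : nat, (f r).2 : nat) != (0, 0)%N])
    ((\prod_r ((f r).1`! * (f r).2`!))%N%:R)^-1 *:
      \prod_(p <- [seq ((f r).1 : nat, (f r).2 : nat) | r <- enum 'I_k])
        (opad X ^+ p.1 * opad Y ^+ p.2).
Proof.
rewrite texp_pairs -[k in LHS]card_ord -prodr_const bigA_distr_big.
apply: eq_big => [f|f _].
  by apply/ffun_onP/forallP => fP r; have := fP r.
by rewrite scaler_prod natr_prod -prodfV big_map enum_index_enum.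
Qed.

Lemma degree_ffun (M k : nat) (f : {ffun 'I_k -> 'I_M * 'I_M}) :
  degree [seq ((f r).1 : nat, (f r).2 : nat) | r <- enum 'I_k] =
  \sum_r ((f r).1 + (f r).2)%N.
Proof. by rewrite /degree big_map big_enum. Qed.

(** Exponents adding up to [n] are at most [n], so the bound [N] of the truncation and the bound [n]
    in the definition of Z_n select the same words. *)
Lemma sum_words_widen k n (nN : (n <= N)%N) :
  \sum_(f : {ffun 'I_k -> 'I_N.+1 * 'I_N.+1} |
        [forall r, ((f r).1 : nat, (f r).2 : nat) != (0, 0)%N] &&
        (\sum_r ((f r).1 + (f r).2) == n)%N)
    ((\prod_r ((f r).1`! * (f r).2`!))%N%:R)^-1 *:
      rlie_monomial x y
        [seq ((f r).1 : nat, (f r).2 : nat) | r <- enum 'I_k] =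
  \sum_(f : {ffun 'I_k -> 'I_n.+1 * 'I_n.+1} |
        [forall r, ((f r).1 : nat, (f r).2 : nat) != (0, 0)%N] &&
        (\sum_r ((f r).1 + (f r).2) == n)%N)
    ((\prod_r ((f r).1`! * (f r).2`!))%N%:R)^-1 *:
      rlie_monomial x y
        [seq ((f r).1 : nat, (f r).2 : nat) | r <- enum 'I_k].
Proof.
pose w := widen_ord (nN : (n.+1 <= N.+1)%N).
pose h (f : {ffun 'I_k -> 'I_n.+1 * 'I_n.+1}) :=
  [ffun r => (w (f r).1, w (f r).2)].
pose h' (f : {ffun 'I_k -> 'I_N.+1 * 'I_N.+1}) :=
  [ffun r => (inord (f r).1 : 'I_n.+1, inord (f r).2 : 'I_n.+1)].
have hh' f : h' (h f) = f.
  apply/ffunP => r; rewrite !ffunE /= [RHS]surjective_pairing.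
  by congr pair; apply/val_inj; rewrite /= inordK.
rewrite (reindex_onto h h') => [|f /andP[_ /eqP fn]]; last first.
  apply/ffunP => r; rewrite !ffunE [RHS]surjective_pairing.
  have : ((f r).1 + (f r).2 <= n)%N.
    by rewrite -fn (bigD1 r)//= leq_addr.
  move=> fr; congr pair; apply/val_inj; rewrite /= inordK ?ltnS//.
    exact: leq_trans (leq_addr _ _) fr.
  exact: leq_trans (leq_addl _ _) fr.
apply: eq_big => [f|f _].
  rewrite hh' eqxx andbT; congr (_ && _).
    by apply: eq_forallb => r; rewrite ffunE.
  by congr (_ == _); apply: eq_bigr => r _; rewrite ffunE.
congr (_%:R^-1 *: rlie_monomial x y _).
  by apply: eq_bigr => r _; rewrite ffunE.
by apply: eq_map => r; rewrite ffunE.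
Qed.

(** The identity [opad_log_prod] is applied to the Euler operator and then to the constant series
    [1]. In degree [n] one side is - n q_n, the other minus the sum over words. *)
Lemma dynkin_coef (q : {poly A}) n :
  tlog N (texp N X * texp N Y - 1) = tmul q -> (0 < n <= N)%N ->
  q`_n = rbch_term x y n.
Proof.
move=> qE /andP[n0 nN].
have iN : (n < N.+1)%N by [].
have := congr1 (fun f : flend (flend_filt (tseries A N)) => (f D : flend _) (tone N))
  (opad_log_prod lX lY).
rewrite qE opad_teuler => /ffunP /(_ (Ordinal iN)).
rewrite flend_oppE toppE tmul_tone /= coefMX coef_deriv eqn0Ngt n0 /= prednK//.
have -> : (tlog N (texp N (opad X) * texp N (opad Y) - 1) D : flend _) (tone N)
    (Ordinal iN) =
  - \sum_(k < N.+1) ((-1) ^+ k.+1 / k%:R) *: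
    \sum_(f : {ffun 'I_k -> 'I_n.+1 * 'I_n.+1} |
          [forall r, ((f r).1 : nat, (f r).2 : nat) != (0, 0)%N] &&
          (\sum_r ((f r).1 + (f r).2) == n)%N)
      ((\prod_r ((f r).1`! * (f r).2`!))%N%:R)^-1 *:
        rlie_monomial x y
          [seq ((f r).1 : nat, (f r).2 : nat) | r <- enum 'I_k].
  rewrite /tlog !flend_sumE sum_ffunE -sumrN; apply: eq_bigr => -[k kN] _.
  rewrite flend2_scaleE tscaleE -scalerN.
  (* The coefficient for [k = 0] is a division by [0], so it vanishes. *)
  case: k kN => [|k] kN; first by rewrite [X in _ / X]mulr0n invr0 mulr0 !scale0r.
  congr (_ *: _); rewrite texp_pairsX !flend_sumE sum_ffunE.
  rewrite -sum_words_widen// -sumrN [RHS]big_mkcondr; apply: eq_bigr => f f0.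
  rewrite flend2_scaleE lie_word; first last.
  - apply/allP => p /mapP[r _ ->]; exact: (forallP f0 r).
  - by rewrite -size_eq0 size_map size_enum_ord.
  rewrite flend_oppE tscaleE toppE tmul_tone /= coefCM coefXn degree_ffun.
  by rewrite eq_sym; case: eqP; rewrite ?mulr1 ?mulr0 ?oppr0 ?scaler0 ?scalerN.
move=> /oppr_inj qn; apply/(@scalerI _ _ n%:R); first by rewrite pnatr_eq0 -lt0n.
rewrite scaler_nat qn /rbch_term scalerA divff ?pnatr_eq0 -?lt0n// scale1r.
rewrite -(big_mkord xpredT (fun k => ((-1) ^+ k.+1 / k%:R) *:
    \sum_(f : {ffun 'I_k -> 'I_n.+1 * 'I_n.+1} |
          [forall r, ((f r).1 : nat, (f r).2 : nat) != (0, 0)%N] &&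
          (\sum_r ((f r).1 + (f r).2) == n)%N)
      ((\prod_r ((f r).1`! * (f r).2`!))%N%:R)^-1 *:
        rlie_monomial x y
          [seq ((f r).1 : nat, (f r).2 : nat) | r <- enum 'I_k])).
rewrite (big_cat_nat _ (n := n.+1))//= [X in _ + X]big_nat_cond [X in _ + X]big1 ?addr0.
  by rewrite big_ltn// invr0 mulr0 scale0r add0r.
(* Each of the [k] nonzero pairs contributes at least [1] to the degree, so no word with [k > n] has
   degree [n]. *)
move=> k /andP[/andP[nk _] _]; rewrite big1 ?scaler0// => f /andP[/forallP f0 /eqP fn].
suff : (k <= n)%N by rewrite leqNgt nk.
rewrite -fn -[k in (k <= _)%N]card_ord -sum1_card leq_sum// => r _.
by have := f0 r; rewrite xpair_eqE negb_and -!lt0n; lia.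
Qed.

(** The logarithm of e^(tx) e^(ty) is a multiplication operator whose coefficients are the Z_n, by
    [dynkin_coef]; its exponential is the product by [texp_log_prod]. *)
Lemma rbch_exp n : (n <= N)%N ->
  \sum_(k < N.+1) k`!%:R^-1 *: ((\poly_(m < N.+1) rbch_term x y m) ^+ k)`_n =
  exp_prod_coef x y n.
Proof.
move=> nN; have iN : (n < N.+1)%N by [].
rewrite -(texp_prod_coef nN).
have [q qE] : exists q, tlog N (texp N X * texp N Y - 1) = tmul q.
  rewrite /X /Y !texp_tmulX -tmulM -(tmul1 N) -tmulB; exact: tlog_tmul.
have q0 : q`_0 = 0.
  have lq : lev 1 (tmul q : flend (tseries A N)) by rewrite -qE; exact: lev1_log_prod.
  have := lq 0%N (tone N) (fil_all _) ord0 (leqnn _).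
  by rewrite tmul_tone.
have qP : tmul q = tmul (\poly_(m < N.+1) rbch_term x y m) :> flend (tseries A N).
  (* [rbch_term] vanishes at [0] because its prefactor is the inverse of [0]. *)
  apply: eq_tmul => -[_|m mN]; rewrite coef_poly; first by rewrite q0 /rbch_term invr0 scale0r.
  by rewrite ltnS mN (dynkin_coef qE).
have := texp_log_prod lX lY; rewrite qE qP {1}/X {1}/Y !texp_tmulX -tmulM.
move=> /(congr1 (fun f : flend (tseries A N) => (f (tone N) : {ffun _ -> _}) (Ordinal iN))).
rewrite [RHS]tmul_tone /= => <-; rewrite /texp flend_sumE sum_ffunE.
by apply: eq_bigr => k _; rewrite flend_scaleE tscaleE -tmulX tmul_tone.
Qed.

End Dynkin.

(** * The formal Mercator series *)

Section FormalMercator.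
Context {K : numFieldType} {A : algType K}.
Implicit Types w : A.

Definition rmercator_term w n : A := ((-1) ^+ n.+1 / n%:R) *: w ^+ n.

(** The coefficients of exp(log(1 + w t)) = 1 + w t. *)
Lemma rmercator_exp w N n : (n <= N)%N ->
  \sum_(k < N.+1) k`!%:R^-1 *: ((\poly_(m < N.+1) rmercator_term w m) ^+ k)`_n =
  if n is n'.+1 then if n' is 0%N then w else 0 else 1.
Proof.
move=> nN; have iN : (n < N.+1)%N by [].
have lW : lev 1 (tmul (w%:P * 'X) : flend (tseries A N)).
  by apply: lev_tmul; rewrite coefMX.
have qE : tlog N (tmul (w%:P * 'X)) = tmul (\poly_(m < N.+1) rmercator_term w m)
    :> flend (tseries A N).
  rewrite poly_def tmul_sum; apply: eq_bigr => k _; rewrite -tmulX -tmulZ.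
  congr tmul; rewrite exprMn_comm; last exact: commr_polyX.
  by rewrite -rmorphXn /= mul_polyC scalerA mulr_algl.
have := texp_tlog (lev1_nilp lW); rewrite qE -tmul1 -tmulD.
move=> /(congr1 (fun f : flend (tseries A N) => (f (tone N) : {ffun _ -> _}) (Ordinal iN))).
rewrite [RHS]tmul_tone /= coefD coefC coefMX coefC.
have sumE : (texp N (tmul (\poly_(m < N.+1) rmercator_term w m)) (tone N) : {ffun _ -> _})
    (Ordinal iN) = \sum_(k < N.+1)
      k`!%:R^-1 *: ((\poly_(m < N.+1) rmercator_term w m) ^+ k)`_n.
  rewrite /texp flend_sumE sum_ffunE; apply: eq_bigr => k _.
  by rewrite flend_scaleE tscaleE -tmulX tmul_tone.
rewrite sumE => ->.
by case: n {nN iN sumE} => [|[|n]] /=; rewrite ?addr0 ?add0r.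
Qed.

(** The case of degree [1] of [rbch_exp], where only the linear term of the exponential contributes;
    this avoids the sum over words. *)
Lemma rbch_term1 (x y : A) : rbch_term x y 1 = x + y.
Proof.
have := rbch_exp x y (leqnn 1); rewrite !big_ord_recl !big_ord0 /= expr0 expr1.
rewrite coefC coef_poly /= scaler0 add0r addr0.
rewrite /exp_prod_coef !big_ord_recl !big_ord0 /bump.
rewrite !(fact0, addn0, subn0, subnn, add1n, muln1, mul1n, expr0, expr1, addr0, mulr1, mul1r, leqnn).
by rewrite invr1 !scale1r.
Qed.
End FormalMercator.

(** * Power series in a normed algebra *)

Section RealExponential.
Context {R : realType}.

Definition rexp N (r : R) : R := \sum_(k < N.+1) k`!%:R^-1 * r ^+ k.

Lemma rexpE N r : rexp N r = series (exp_coeff r) N.+1.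
Proof.
by rewrite /rexp seriesEord; apply: eq_bigr => k _; rewrite /exp_coeff /= mulrC.
Qed.

Lemma rexp_ge0 N r : 0 <= r -> 0 <= rexp N r.
Proof. by move=> r0; apply: sumr_ge0 => k _; rewrite mulr_ge0 ?invr_ge0 ?exprn_ge0. Qed.

Lemma rexp_le N r : 0 <= r -> rexp N r <= expR r.
Proof.
move=> r0; rewrite rexpE; apply: nondecreasing_cvgn_le; last exact: is_cvg_series_exp_coeff.
by apply: nondecreasing_series => n _ _; exact: exp_coeff_ge0.
Qed.

Lemma cvg_rexp r : rexp ^~ r @ \oo --> expR r.
Proof.
rewrite (_ : rexp ^~ r = [sequence series (exp_coeff r) n.+1]_n); last first.
  by apply/funext => n; rewrite rexpE.
by rewrite cvg_shiftS; exact: is_cvg_series_exp_coeff.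
Qed.

End RealExponential.

Section SeminormedAlgebra.
Context {R : realType} {A : algType R} (nm : A -> R).
Hypothesis nm_ge0 : forall x, 0 <= nm x.
Hypothesis nmD : forall x y, nm (x + y) <= nm x + nm y.
Hypothesis nmM : forall x y, nm (x * y) <= nm x * nm y.
Hypothesis nmZ : forall r x, nm (r *: x) = `|r| * nm x.

Lemma nm0 : nm 0 = 0.
Proof. by rewrite -(scale0r 0) nmZ normr0 mul0r. Qed.

Lemma nmN x : nm (- x) = nm x.
Proof. by rewrite -scaleN1r nmZ normrN1 mul1r. Qed.

Lemma nmBC x y : nm (x - y) = nm (y - x).
Proof. by rewrite -opprB nmN. Qed.

Lemma nm_sum (I : Type) (r : seq I) (P : pred I) (F : I -> A) :
  nm (\sum_(i <- r | P i) F i) <= \sum_(i <- r | P i) nm (F i).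
Proof.
elim/big_ind2: _ => [|x1 x2 y1 y2 h1 h2|//]; first by rewrite nm0.
exact: le_trans (nmD _ _) (lerD h1 h2).
Qed.

(* [nm 1] may be any number: this is the price of bounding empty products. *)
Let C1 := 1 + nm 1.

Let C1_ge0 : 0 <= C1. Proof. by rewrite addr_ge0. Qed.
Let C1_ge1 : 1 <= C1. Proof. by rewrite lerDl. Qed.

Lemma nmX x k : nm (x ^+ k) <= C1 * nm x ^+ k.
Proof.
elim: k => [|k IH]; first by rewrite !expr0 mulr1 lerDr.
rewrite !exprS; apply: (le_trans (nmM _ _)).
by rewrite mulrCA; apply: ler_wpM2l.
Qed.

Lemma nm_exprB x y r k : nm x <= r -> nm y <= r ->
  nm (x ^+ k.+1 - y ^+ k.+1) <= C1 * (k.+1%:R * r ^+ k * nm (x - y)).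
Proof.
move=> xr yr; have r0 : 0 <= r := le_trans (nm_ge0 x) xr.
elim: k => [|k IH].
  by rewrite !expr1 expr0 !mul1r ler_peMl.
have -> : x ^+ k.+2 - y ^+ k.+2 = x * (x ^+ k.+1 - y ^+ k.+1) + (x - y) * y ^+ k.+1.
  by rewrite mulrBr mulrBl addrA subrK -!exprS.
apply: (le_trans (nmD _ _)).
apply: (@le_trans _ _ (r * (C1 * (k.+1%:R * r ^+ k * nm (x - y))) +
   nm (x - y) * (C1 * r ^+ k.+1))).
  apply: lerD; apply: (le_trans (nmM _ _)).
    by apply: ler_pM.
  apply: ler_wpM2l => //; apply: (le_trans (nmX _ _)).
  by apply: ler_wpM2l => //; rewrite lerXn2r ?nnegrE.
rewrite le_eqVlt; apply/orP; left; apply/eqP.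
by rewrite [k.+2%:R]mulrS exprS; ring.
Qed.

(** By telescoping, x^k - y^k costs a factor k r^(k-1); divided by k! these factors again form a
    truncated exponential of [r]. The constant does not depend on [N]. *)
Lemma texp_lip N x y r : nm x <= r -> nm y <= r ->
  nm (texp N x - texp N y) <= C1 * (expR r * nm (x - y)).
Proof.
move=> xr yr; have r0 : 0 <= r := le_trans (nm_ge0 x) xr.
apply: (@le_trans _ _ (C1 * (rexp N r * nm (x - y)))); last first.
  by rewrite ler_wpM2l// ler_wpM2r// rexp_le.
rewrite /texp -sumrB big_ord_recl !expr0 subrr add0r.
apply: (le_trans (nm_sum _ _ _)).
case: N => [|N]; first by rewrite big_ord0 !mulr_ge0// rexp_ge0.
apply: (@le_trans _ _ (C1 * (rexp N r * nm (x - y)))); last first.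
  rewrite ler_wpM2l// ler_wpM2r// {2}/rexp big_ord_recr /= lerDl.
  by rewrite mulr_ge0 ?exprn_ge0// invr_ge0.
rewrite /rexp mulr_suml mulr_sumr; apply: ler_sum => k _.
rewrite -scalerBr nmZ ger0_norm ?invr_ge0//.
rewrite -ler_pdivlMl ?invr_gt0 ?ltr0n ?fact_gt0// invrK.
apply: (le_trans (nm_exprB _ xr yr)).
rewrite le_eqVlt; apply/orP; left; apply/eqP; rewrite factS natrM.
have : k`!%:R != 0 :> R by rewrite pnatr_eq0 -lt0n fact_gt0.
by move=> ?; field.
Qed.

(** Convergence is spelled out with real tolerances because [A] carries only the function [nm] here,
    and no topology. *)
Definition tends (u : nat -> A) (l : A) : Prop :=
  forall e : R, 0 < e -> exists M, forall n, (M <= n)%N -> nm (l - u n) <= e.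

End SeminormedAlgebra.

(** * Abel summation and the exponential of a convergent series *)

Section PowerSeries.
Context {R : realType} {A : algType R} (nm : A -> R).
Hypothesis nm_ge0 : forall x, 0 <= nm x.
Hypothesis nmD : forall x y, nm (x + y) <= nm x + nm y.
Hypothesis nmM : forall x y, nm (x * y) <= nm x * nm y.
Hypothesis nmZ : forall r x, nm (r *: x) = `|r| * nm x.
Variables (a c : nat -> A).
Let C1 := 1 + nm 1.
Let C1_ge0 : 0 <= C1. Proof. by rewrite addr_ge0. Qed.

Definition psum N (t : R) : A := \sum_(n < N.+1) t ^+ n *: a n.
Let P N : {poly A} := \poly_(n < N.+1) a n.
Let Q N : {poly R} := \poly_(n < N.+1) nm (a n).

Lemma Q_ge0 N k i : 0 <= (Q N ^+ k)`_i.
Proof.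
elim: k i => [|k IH] i; first by rewrite expr0 coefC; case: ifP.
rewrite exprS coefM sumr_ge0// => j _; rewrite mulr_ge0//.
by rewrite coef_poly; case: ifP.
Qed.

(** [Q N] is a coefficientwise majorant of [P N], and so are its powers; [C1] accounts for the power
    [0]. *)
Lemma nm_coef_exp N k i : nm (P N ^+ k)`_i <= C1 * (Q N ^+ k)`_i.
Proof.
elim: k i => [|k IH] i.
  rewrite !expr0 !coefC; case: ifP => _; first by rewrite mulr1 lerDr.
  by rewrite (nm0 nmZ) mulr0.
rewrite !exprS !coefM; apply: (le_trans (nm_sum nmD nmZ _ _ _)).
rewrite mulr_sumr; apply: ler_sum => j _; apply: (le_trans (nmM _ _)).
rewrite mulrCA; apply: ler_pM => //.
by rewrite !coef_poly; case: ifP => // _; rewrite (nm0 nmZ).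
Qed.

Lemma horner_scalar (p : {poly A}) (t : R) n : (size p <= n)%N ->
  p.[t%:A] = \sum_(i < n) t ^+ i *: p`_i.
Proof.
move=> pn; rewrite (horner_coef_wide _ pn); apply: eq_bigr => i _.
by rewrite exprZn expr1n -scalerAr mulr1.
Qed.

Lemma size_P_exp N k : (k <= N)%N -> (size (P N ^+ k) <= N * N + N.+1)%N.
Proof.
move=> kN; apply: (leq_trans (size_poly_exp_leq _ _)).
have : ((size (P N)).-1 <= N)%N by have := size_poly N.+1 a; rewrite -/(P N); lia.
by move=> PN; rewrite addnS ltnS (leq_trans (leq_mul PN kN))// leq_addr.
Qed.

Lemma psum_exp N k (t : R) : (k <= N)%N ->
  psum N t ^+ k = \sum_(i < N * N + N.+1) t ^+ i *: (P N ^+ k)`_i.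
Proof.
move=> kN; rewrite -horner_scalar ?size_P_exp// horner_exp_comm; last first.
  by rewrite /comm_poly mulr_algl mulr_algr.
congr (_ ^+ k); rewrite (@horner_scalar _ _ N.+1) ?size_poly//.
by apply: eq_bigr => i _; rewrite coef_poly ltn_ord.
Qed.

(** [c] is the sequence of coefficients of the formal exponential of the series with coefficients
    [a]. *)
Hypothesis formal_exp : forall N n, (n <= N)%N ->
  \sum_(k < N.+1) k`!%:R^-1 *: (P N ^+ k)`_n = c n.

(** At t = s^2 the coefficients up to degree [N] cancel. Beyond, t^i <= s^(N+1) s^i: the first
    factor gives the decay, and the second leaves the majorant at [s], bounded by the exponential of
    the geometric series C0 / (1 - s). *)
Lemma psum_tail N (s C0 : R) : 0 <= s -> s < 1 -> (forall n, nm (a n) <= C0) ->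
  nm (texp N (psum N (s ^+ 2)) - \sum_(i < N.+1) (s ^+ 2) ^+ i *: c i) <=
  C1 * expR (C0 / (1 - s)) * s ^+ N.+1.
Proof.
move=> s0 s1 aC; set t := s ^+ 2; set L := (N * N + N.+1)%N.
have -> : texp N (psum N t) =
    \sum_(i < L) t ^+ i *: \sum_(k < N.+1) k`!%:R^-1 *: (P N ^+ k)`_i.
  under [RHS]eq_bigr do rewrite scaler_sumr.
  rewrite exchange_big; apply: eq_bigr => k _.
  have kN : (k <= N)%N by rewrite -ltnS.
  rewrite (psum_exp t kN) scaler_sumr; apply: eq_bigr => i _.
  by rewrite !scalerA mulrC.
have NL : (N.+1 <= L)%N by rewrite leq_addl.
rewrite (big_ord_widen _ (fun i => t ^+ i *: c i) NL) [X in _ - X]big_mkcond -sumrB.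
apply: (le_trans (nm_sum nmD nmZ _ _ _)).
apply: (@le_trans _ _ (\sum_(i < L) (C1 * s ^+ N.+1) *
    (\sum_(k < N.+1) k`!%:R^-1 * ((Q N ^+ k)`_i * s ^+ i)))).
  apply: ler_sum => i _; case: ltnP => iN.
    rewrite formal_exp// subrr (nm0 nmZ) !mulr_ge0 ?exprn_ge0//.
    by apply: sumr_ge0 => k _; rewrite !mulr_ge0 ?invr_ge0 ?exprn_ge0 ?Q_ge0.
  rewrite subr0 nmZ ger0_norm ?exprn_ge0//.
  apply: (@le_trans _ _ (s ^+ N.+1 * s ^+ i *
      (C1 * \sum_(k < N.+1) k`!%:R^-1 * (Q N ^+ k)`_i))).
    apply: ler_pM => //; first by rewrite !exprn_ge0.
      rewrite /t -exprM mul2n -addnn exprD ler_wpM2r ?exprn_ge0//.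
      by rewrite ler_wiXn2l// ltW.
    apply: (le_trans (nm_sum nmD nmZ _ _ _)); rewrite mulr_sumr.
    apply: ler_sum => k _; rewrite nmZ ger0_norm ?invr_ge0// mulrCA.
    by rewrite ler_wpM2l ?invr_ge0// nm_coef_exp.
  rewrite !mulr_sumr le_eqVlt; apply/orP; left; apply/eqP.
  by apply: eq_bigr => k _; ring.
rewrite -mulr_sumr exchange_big /= mulrAC ler_wpM2r ?exprn_ge0// ler_wpM2l//.
have q0 : 0 <= (Q N).[s].
  rewrite horner_coef sumr_ge0// => i _; rewrite mulr_ge0 ?exprn_ge0//.
  by have := Q_ge0 N 1 i; rewrite expr1.
have C0_ge0 : 0 <= C0 := le_trans (nm_ge0 _) (aC 0%N).
have s1' : 0 < 1 - s by rewrite subr_gt0.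
have qC : (Q N).[s] <= C0 / (1 - s).
  rewrite (horner_coef_wide _ (size_poly _ _)).
  apply: (@le_trans _ _ (\sum_(i < N.+1) C0 * s ^+ i)).
    by apply: ler_sum => i _; rewrite ler_wpM2r ?exprn_ge0// coef_poly ltn_ord.
  rewrite -mulr_sumr ler_wpM2l// -[leRHS]mul1r ler_pdivlMr// mulrC.
  by rewrite -opprB mulNr -subrX1 opprB gerBl exprn_ge0.
apply: (@le_trans _ _ (rexp N (Q N).[s])); last first.
  by apply: (le_trans (rexp_le _ q0)); rewrite ler_expR.
rewrite /rexp; apply: ler_sum => k _; rewrite -mulr_sumr ler_wpM2l ?invr_ge0//.
rewrite -horner_exp (horner_coef_wide (n := L)) //.
apply: (leq_trans (size_poly_exp_leq _ _)).
have QN : ((size (Q N)).-1 <= N)%N.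
  by have := size_poly N.+1 (fun n => nm (a n)); rewrite -/(Q N); lia.
have kN : (k <= N)%N by rewrite -ltnS.
by rewrite /L addnS ltnS (leq_trans (leq_mul QN kN))// leq_addr.
Qed.

Variable V : A.
Let s N := \sum_(n < N.+1) a n.

Lemma bernoulli_le (t : R) n : 0 <= t -> t <= 1 -> 1 - t ^+ n <= n%:R * (1 - t).
Proof.
move=> t0 t1; elim: n => [|n IH]; first by rewrite expr0 mul0r subrr.
have tn : t ^+ n <= 1 by rewrite exprn_ile1.
by rewrite exprS mulrS; nra.
Qed.

(** Summation by parts, written with the remainders [V - s n]. *)
Lemma abel_summation N t :
  V - psum N t = t ^+ N *: (V - s N) + (1 - t) *: \sum_(n < N) t ^+ n *: (V - s n).
Proof.
elim: N => [|N IH].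
  by rewrite /psum /s !big_ord1 big_ord0 expr0 !scale1r scaler0 addr0.
rewrite /psum big_ord_recr /= -/(psum N t) opprD addrA IH big_ord_recr /=.
have -> : a N.+1 = (V - s N) - (V - s N.+1).
  rewrite /s [in X in _ - (_ - X)]big_ord_recr /= opprB addrA.
  by rewrite [V - _ + _]addrA subrK addrAC subrr add0r.
move: (V - s N) (V - s N.+1) (\sum_(_ < N) _) => u u' S.
rewrite [in RHS]scalerDr scalerA mulrBl mul1r scalerBl -exprS scalerBr opprB.
by rewrite addrCA; congr (_ + _); rewrite !scalerBl addrAC addrC.
Qed.

(** The weights t^N and (1 - t) t^n, n < N, add up to [1], so small remainders contribute at most
    [d]; the first [M] ones carry a factor [1 - t]. The bound is uniform in [N]. *)
Lemma abel_bound M (d t : R) N : 0 <= t -> t <= 1 -> 0 <= d ->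
  (forall n, (M <= n)%N -> nm (V - s n) <= d) -> (M <= N)%N ->
  nm (V - psum N t) <= d + (1 - t) * \sum_(n < M) nm (V - s n).
Proof.
move=> t0 t1 d0 sd MN; have t1' : 0 <= 1 - t by rewrite subr_ge0.
rewrite abel_summation; apply: (le_trans (nmD _ _)).
rewrite !nmZ !ger0_norm ?exprn_ge0//.
have geo : (1 - t) * \sum_(n < N) t ^+ n = 1 - t ^+ N.
  by rewrite -opprB mulNr -subrX1 opprB.
apply: (@le_trans _ _ (t ^+ N * d + (1 - t) *
    (d * \sum_(n < N) t ^+ n + \sum_(n < M) nm (V - s n)))); last first.
  by rewrite mulrDr mulrCA geo le_eqVlt; apply/orP; left; apply/eqP; ring.
apply: lerD; first by rewrite ler_wpM2l ?exprn_ge0// sd.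
rewrite ler_wpM2l//; apply: (le_trans (nm_sum nmD nmZ _ _ _)).
rewrite (big_ord_widen _ (fun n => nm (V - s n)) MN) [X in _ + X]big_mkcond.
rewrite mulr_sumr -big_split; apply: ler_sum => n _ /=.
rewrite nmZ ger0_norm ?exprn_ge0//; case: ltnP => nM.
  apply: ler_wpDl; first by rewrite mulr_ge0 ?exprn_ge0.
  by rewrite ler_piMl ?exprn_ile1.
by rewrite addr0 mulrC ler_wpM2r ?exprn_ge0 ?sd.
Qed.

(** Each term is a difference of two consecutive remainders, and these are bounded. *)
Lemma tends_bounded : tends nm s V -> exists C0, forall n, nm (a n) <= C0.
Proof.
move=> /(_ 1 ltr01)[M sM]; pose D := 1 + \sum_(n < M) nm (V - s n).
have sD n : nm (V - s n) <= D.
  case: (ltnP n M) => nM; last by rewrite (le_trans (sM _ nM))// lerDl sumr_ge0.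
  rewrite /D (bigD1 (Ordinal nM))//= addrCA lerDl addr_ge0// sumr_ge0//.
have V0 := nm_ge0 V; have D0 : 0 <= D := le_trans (nm_ge0 _) (sD 0%N).
exists (nm V + D + D) => -[|n].
  have -> : a 0%N = V + - (V - s 0%N) by rewrite /s big_ord1 opprB addrC subrK.
  by have := nmD V (- (V - s 0%N)); rewrite (nmN nmZ); have := sD 0%N; lra.
have -> : a n.+1 = (V - s n) + - (V - s n.+1).
  have -> : s n.+1 = s n + a n.+1 by rewrite /s big_ord_recr.
  by rewrite opprB addrA [V - _ + _]addrA subrK addrAC subrr add0r.
have := nmD (V - s n) (- (V - s n.+1)); rewrite (nmN nmZ).
by have := sD n; have := sD n.+1; lra.
Qed.

(** First [t] is fixed close to [1], then [N] grows. The limit [F] is joined to e^V through the sum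
    of the c_n, the sum of the t^n c_n and the exponential of [psum N t]; each of the four gaps is
    at most [e / 4]. *)
Lemma abel_exp (F : A) (C : R) : tends nm s V ->
  (forall N, \sum_(n < N.+1) n%:R * nm (c n) <= C) ->
  tends nm (fun N => \sum_(n < N.+1) c n) F ->
  tends nm (fun N => texp N V) F.
Proof.
move=> sV cC cF e e0.
have [C0 aC] := tends_bounded sV.
(* The Lipschitz constant of the exponential on the ball of radius [nm V + 1], which contains
   [psum N t] since [d <= 1]. *)
pose Kc := C1 * expR (nm V + 1).
have Kc0 : 0 <= Kc by rewrite mulr_ge0 ?expR_ge0.
pose d := Num.min 1 (e / (4 * (Kc + 1))).
have d0 : 0 < d by rewrite lt_min ltr01 divr_gt0// mulr_gt0// ltr_wpDl.
have d1 : d <= 1 by rewrite ge_min lexx.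
have Kd : Kc * d <= e / 4.
  apply: (@le_trans _ _ (Kc * (e / (4 * (Kc + 1))))).
    by rewrite ler_wpM2l// ge_min lexx orbT.
  rewrite mulrA ler_pdivrMr; last by rewrite mulr_gt0// ltr_wpDl.
  by rewrite mulrA divfK// mulrDr mulr1 [e * Kc]mulrC lerDl ltW.
have [M sM] := sV (d / 2) (divr_gt0 d0 (ltr0n _ 2)).
pose D := \sum_(n < M) nm (V - s n).
have D0 : 0 <= D by rewrite sumr_ge0.
have C0' : 0 <= C by apply: le_trans (cC 0%N); rewrite big_ord1 mul0r.
(* For t = (1 - h)^2 one has 1 - t <= 2 h. The last two bounds control the first [M] remainders in
   [abel_bound] and the gap between the sums of c_n and of t^n c_n. *)
have [h [h0 h1 hD hC]] : exists h : R,
    [/\ 0 < h, h <= 1 / 2, 2 * h * D <= d / 2 & 2 * h * C <= e / 4].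
  pose h := Num.min (1 / 2) (Num.min (d / (4 * (D + 1))) (e / (8 * (C + 1)))).
  have h0 : 0 < h by rewrite !lt_min !divr_gt0// mulr_gt0// ltr_wpDl.
  exists h; split => //.
  - by rewrite ge_min lexx.
  - have : h <= d / (4 * (D + 1)) by rewrite !ge_min lexx !orbT.
    rewrite ler_pdivlMr; last by rewrite mulr_gt0// ltr_wpDl.
    by have := ltW h0; nra.
  - have : h <= e / (8 * (C + 1)) by rewrite !ge_min lexx !orbT.
    rewrite ler_pdivlMr; last by rewrite mulr_gt0// ltr_wpDl.
    by have := ltW h0; nra.
pose r := 1 - h; pose t := r ^+ 2.
have r0 : 0 <= r by rewrite /r; lra.
have r1 : r < 1 by rewrite /r; lra.
have t0 : 0 <= t by rewrite exprn_ge0.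
have t1 : t <= 1 by rewrite exprn_ile1 // ltW.
have th : 1 - t <= 2 * h by rewrite /t /r; nra.
have [M2 rM2] : exists M2, forall n, (M2 <= n)%N ->
    C1 * expR (C0 / (1 - r)) * r ^+ n.+1 <= e / 4.
  have : (fun n => C1 * expR (C0 / (1 - r)) * r ^+ n) @ \oo -->
         C1 * expR (C0 / (1 - r)) * 0.
    by apply: cvgMr; apply: cvg_expr; rewrite ger0_norm.
  rewrite mulr0 => /cvgrPdist_le /(_ (e / 4)); case; first by rewrite divr_gt0.
  move=> M2 _ H; exists M2 => n Mn; have := H n.+1 (leqW Mn).
  by rewrite sub0r normrN; apply: le_trans; exact: ler_norm.
have [M3 cM3] := cF (e / 4) (divr_gt0 e0 (ltr0n _ 4)).
exists (maxn M (maxn M2 M3)) => N; rewrite !geq_max => /and3P[MN M2N M3N].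
have VS : nm (V - psum N t) <= d.
  apply: (le_trans (abel_bound t0 t1 _ sM MN)); first by rewrite divr_ge0// ltW.
  have : (1 - t) * D <= 2 * h * D by rewrite ler_wpM2r.
  by rewrite -/D; lra.
have E1 : nm (texp N (psum N t) - texp N V) <= e / 4.
  apply: le_trans Kd; rewrite (nmBC nmZ) /Kc -mulrA.
  apply: (@le_trans _ _ (C1 * (expR (nm V + 1) * nm (V - psum N t)))); last first.
    by rewrite ler_wpM2l// ler_wpM2l// expR_ge0.
  apply: (texp_lip nm_ge0 nmD nmM nmZ); first by rewrite lerDl.
  have -> : psum N t = V + - (V - psum N t) by rewrite opprB addrC subrK.
  apply: (le_trans (nmD _ _)); rewrite (nmN nmZ) lerD2l.
  exact: le_trans VS d1.
have E2 := le_trans (psum_tail N r0 r1 aC) (rM2 N M2N).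
have E3 : nm (\sum_(i < N.+1) c i - \sum_(i < N.+1) t ^+ i *: c i) <= e / 4.
  rewrite -sumrB; apply: (le_trans (nm_sum nmD nmZ _ _ _)).
  apply: (@le_trans _ _ ((1 - t) * \sum_(n < N.+1) n%:R * nm (c n))); last first.
    apply: (@le_trans _ _ ((1 - t) * C)); first by rewrite ler_wpM2l ?subr_ge0.
    by apply: le_trans hC; rewrite ler_wpM2r.
  rewrite mulr_sumr; apply: ler_sum => n _.
  rewrite -[X in X - _]scale1r -scalerBl nmZ ger0_norm; last first.
    by rewrite subr_ge0 exprn_ile1.
  by rewrite mulrA ler_wpM2r// mulrC bernoulli_le.
have -> : F - texp N V = (F - \sum_(i < N.+1) c i) +
   ((\sum_(i < N.+1) c i - \sum_(i < N.+1) t ^+ i *: c i) +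
   (- (texp N (psum N t) - \sum_(i < N.+1) t ^+ i *: c i) +
   (texp N (psum N t) - texp N V))).
  by rewrite opprB !subrKA.
have := cM3 N M3N; have := nmN nmZ (texp N (psum N t) - \sum_(i < N.+1) t ^+ i *: c i).
move=> nE E4.
apply: (le_trans (nmD _ _)).
have := nmD (\sum_(i < N.+1) c i - \sum_(i < N.+1) t ^+ i *: c i)
   (- (texp N (psum N t) - \sum_(i < N.+1) t ^+ i *: c i) +
   (texp N (psum N t) - texp N V)).
have := nmD (- (texp N (psum N t) - \sum_(i < N.+1) t ^+ i *: c i))
   (texp N (psum N t) - texp N V).
by rewrite nE; move: E1 E2 E3 E4; rewrite -/t; lra.
Qed.

End PowerSeries.

Section FormalIdentitiesConverge.
Context {R : realType} {A : algType R} (nm : A -> R).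
Hypothesis nm_ge0 : forall x, 0 <= nm x.
Hypothesis nmD : forall x y, nm (x + y) <= nm x + nm y.
Hypothesis nmM : forall x y, nm (x * y) <= nm x * nm y.
Hypothesis nmZ : forall r x, nm (r *: x) = `|r| * nm x.
Let C1 := 1 + nm 1.
Let C1_ge0 : 0 <= C1. Proof. by rewrite addr_ge0. Qed.

Lemma tends_le (u : nat -> A) l (b : nat -> R) :
  b @ \oo --> 0 -> (forall n, nm (l - u n) <= b n) -> tends nm u l.
Proof.
move=> /cvgrPdist_le b0 ub e e0; have [M _ H] := b0 e e0.
exists M => n Mn; apply: le_trans (ub n) _; have := H n Mn.
by rewrite sub0r normrN; apply: le_trans; exact: ler_norm.
Qed.

Lemma tends_cvg (u : nat -> A) l : tends nm u l -> (fun n => nm (l - u n)) @ \oo --> 0.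
Proof.
move=> ul; apply/cvgrPdist_le => e e0; have [M uM] := ul e e0.
by exists M => // n Mn /=; rewrite sub0r normrN ger0_norm//; exact: uM.
Qed.

Lemma tendsM (u v : nat -> A) l m :
  tends nm u l -> tends nm v m -> tends nm (fun n => u n * v n) (l * m).
Proof.
move=> /tends_cvg ul /tends_cvg vm.
apply: (@tends_le _ _ (fun n => nm (l - u n) * nm m +
    (nm l + nm (l - u n)) * nm (m - v n))) => [|n].
  rewrite -[X in _ --> X](_ : 0 * nm m + (nm l + 0) * 0 = 0); last by rewrite mul0r mulr0 addr0.
  apply: cvgD; first by apply: cvgMl.
  by apply: cvgM => //; apply: cvgD => //; exact: cvg_cst.
have -> : l * m - u n * v n = (l - u n) * m + u n * (m - v n).
  by rewrite mulrBl mulrBr subrKA.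
apply: le_trans (nmD _ _) _; apply: lerD; first exact: nmM.
apply: le_trans (nmM _ _) _; rewrite ler_wpM2r//.
by have := nmD l (u n - l); rewrite addrC subrK (nmBC nmZ).
Qed.

Lemma mercator_texp w V :
  tends nm (fun N => \sum_(n < N.+1) rmercator_term w n) V ->
  tends nm (fun N => texp N V) (1 + w).
Proof.
(* The coefficients of 1 + w t, for which the sum of n |c_n| is at most [nm w]. *)
move=> wV; pose c n : A := if n is n'.+1 then if n' is 0%N then w else 0 else 1.
apply: (@abel_exp _ _ _ nm_ge0 nmD nmM nmZ (rmercator_term w) c _ _ _ (nm w)) => //.
- by move=> N n nN; rewrite rmercator_exp.
- case=> [|N]; first by rewrite big_ord1 mul0r.
  rewrite !big_ord_recl /= mul0r add0r mul1r big1 ?addr0// => i _.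
  by rewrite (nm0 nmZ) mulr0.
- move=> e e0; exists 1%N => -[//|N] _.
  rewrite !big_ord_recl /= big1 ?addr0 ?subrr ?(nm0 nmZ) ?ltW//.
Qed.

Lemma nm_exp_prod_coef x y n :
  nm (exp_prod_coef x y n) <= C1 ^+ 2 * (n`!%:R^-1 * (nm x + nm y) ^+ n).
Proof.
have := @texp_diag _ (R^o : algType R) (nm x) (nm y) n (mulrC _ _).
rewrite /GRing.scale /= => ->.
rewrite mulr_sumr; apply: le_trans (nm_sum nmD nmZ _ _ _) _.
apply: ler_sum => j _; rewrite nmZ ger0_norm ?invr_ge0// mulrCA.
rewrite ler_wpM2l ?invr_ge0//; apply: le_trans (nmM _ _) _.
rewrite expr2 mulrACA; apply: ler_pM => //; exact: nmX.
Qed.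

(** The difference consists of the terms with [i + j > N]. The same rearrangement for the real
    numbers [nm x] and [nm y] evaluates its majorant, which tends to [0] by the functional equation
    of the real exponential. *)
Lemma texp_prod_tail x y N :
  nm (texp N x * texp N y - \sum_(n < N.+1) exp_prod_coef x y n) <=
  C1 ^+ 2 * (rexp N (nm x) * rexp N (nm y) - rexp N (nm x + nm y)).
Proof.
pose G i j : A := (i`! * j`!)%N%:R^-1 *: (x ^+ i * y ^+ j).
pose g i j : R := (i`! * j`!)%N%:R^-1 * (nm x ^+ i * nm y ^+ j).
have splitE (W : zmodType) (H : nat -> nat -> W) :
    \sum_(i < N.+1) \sum_(j < N.+1) H i j -
    \sum_(n < N.+1) \sum_(j < n.+1) H (n - j)%N j =
    \sum_(i < N.+1) \sum_(j < N.+1 | ~~ (i + j <= N)%N) H i j.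
  rewrite sum_triangle -sumrB; apply: eq_bigr => i _.
  by rewrite (bigID (fun j : 'I__ => (i + j <= N)%N))/= [X in X - _]addrC addrK.
have -> : texp N x * texp N y = \sum_(i < N.+1) \sum_(j < N.+1) G i j.
  rewrite /texp big_distrlr /=; apply: eq_bigr => i _; apply: eq_bigr => j _.
  by rewrite /G natrM invfM -scalerAl -scalerAr scalerA.
have -> : rexp N (nm x) * rexp N (nm y) = \sum_(i < N.+1) \sum_(j < N.+1) g i j.
  rewrite /rexp big_distrlr /=; apply: eq_bigr => i _; apply: eq_bigr => j _.
  by rewrite /g natrM invfM mulrACA.
have -> : rexp N (nm x + nm y) = \sum_(n < N.+1) \sum_(j < n.+1) g (n - j)%N j.
  apply: eq_bigr => n _.
  exact: (@texp_diag _ (R^o : algType R) (nm x) (nm y) n (mulrC _ _)).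
rewrite (splitE _ G) (splitE _ g).
apply: le_trans (nm_sum nmD nmZ _ _ _) _; rewrite mulr_sumr; apply: ler_sum => i _.
apply: le_trans (nm_sum nmD nmZ _ _ _) _; rewrite mulr_sumr; apply: ler_sum => j _.
rewrite nmZ ger0_norm ?invr_ge0// mulrCA ler_wpM2l ?invr_ge0//.
apply: le_trans (nmM _ _) _; rewrite expr2 mulrACA; apply: ler_pM => //; exact: nmX.
Qed.

Lemma bch_texp x y ex ey V :
  tends nm (fun N => texp N x) ex -> tends nm (fun N => texp N y) ey ->
  tends nm (fun N => \sum_(n < N.+1) rbch_term x y n) V ->
  tends nm (fun N => texp N V) (ex * ey).
Proof.
move=> xe ye VE; pose r := nm x + nm y.
have r0 : 0 <= r by rewrite addr_ge0.
(* The constant is the sum of n r^n / n!, that is r e^r, times the square of [C1] from the two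
   powers in each product. *)
apply: (@abel_exp _ _ _ nm_ge0 nmD nmM nmZ (rbch_term x y) (exp_prod_coef x y)
  _ _ _ (C1 ^+ 2 * (r * expR r))) => //.
- by move=> N n nN; exact: rbch_exp.
- move=> N; apply: (@le_trans _ _ (C1 ^+ 2 * (r * rexp N r))); last first.
    by rewrite ler_wpM2l ?exprn_ge0// ler_wpM2l// rexp_le.
  rewrite big_ord_recl mul0r add0r /rexp big_ord_recr /= mulrDr mulrDr.
  rewrite -[leLHS]addr0; apply: lerD; last first.
    by rewrite !mulr_ge0 ?exprn_ge0 ?invr_ge0.
  rewrite !mulr_sumr; apply: ler_sum => k _; rewrite /bump add1n.
  apply: (@le_trans _ _ (k.+1%:R * (C1 ^+ 2 * (k.+1`!%:R^-1 * r ^+ k.+1)))).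
    by rewrite ler_wpM2l// nm_exp_prod_coef.
  rewrite le_eqVlt; apply/orP; left; apply/eqP; rewrite factS natrM [r ^+ _]exprS.
  have : k`!%:R != 0 :> R by rewrite pnatr_eq0 -lt0n fact_gt0.
  by move=> ?; field; rewrite andbC; apply/andP; split => //; rewrite -natr1 addrC ?pnatr_eq0.
- have /tends_cvg xy0 := tendsM xe ye.
  apply: (@tends_le _ _ (fun N => nm (ex * ey - texp N x * texp N y) +
     C1 ^+ 2 * (rexp N (nm x) * rexp N (nm y) - rexp N r))) => [|N]; last first.
    rewrite -(subrKA (texp N x * texp N y)); apply: le_trans (nmD _ _) _.
    by rewrite lerD2l texp_prod_tail.
  rewrite -[X in _ --> X](_ : 0 + C1 ^+ 2 * (expR (nm x) * expR (nm y) - expR r) = 0); last first.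
    by rewrite -expRD subrr mulr0 addr0.
  apply: cvgD => //; apply: cvgMr; apply: cvgB; last exact: cvg_rexp.
  by apply: cvgM; exact: cvg_rexp.
Qed.

End FormalIdentitiesConverge.

(** * Banach algebras *)

(* [A] as an algebra over R, its scalars being restricted along [iota]. *)
Definition restricted (R : realType) (K : numFieldType) (iota : {rmorphism R -> K})
  (A : banachAlgType K) (nontriv : (1 : A) != 0) : Type := banach_sort A.

Section RestrictionOfScalars.
Context {R : realType} {K : numFieldType} (iota : {rmorphism R -> K}).
Hypothesis iota_mono : {mono iota : x y / x <= y}.
Hypothesis iota_surj : forall k : K, 0 <= k -> exists r, iota r = k.

Lemma iota_norm r : `|iota r| = iota `|r|.
Proof.
case: (leP 0 r) => r0.
  by rewrite !ger0_norm// -(rmorph0 iota) iota_mono.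
by rewrite !ltr0_norm ?rmorphN// -(rmorph0 iota) (leW_mono iota_mono).
Qed.

Section Algebra.
Variables (A : banachAlgType K) (nontriv : (1 : A) != 0).

Local Notation A_R := (restricted iota nontriv).

HB.instance Definition _ := GRing.PzRing.copy A_R (banach_sort A).
HB.instance Definition _ := GRing.PzSemiRing_isNonZero.Build A_R nontriv.

Definition rscale (r : R) (x : A_R) : A_R := iota r *: (x : A).

Fact rscaleA a b x : rscale a (rscale b x) = rscale (a * b) x.
Proof. by rewrite /rscale scalerA rmorphM. Qed.
Fact rscale1 : left_id 1 rscale.
Proof. by move=> x; rewrite /rscale rmorph1 scale1r. Qed.
Fact rscaleDr : right_distributive rscale +%R.
Proof. by move=> a x y; exact: scalerDr. Qed.
Fact rscaleDl x : {morph rscale^~ x : a b / a + b}.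
Proof. by move=> a b; rewrite /rscale rmorphD scalerDl. Qed.
HB.instance Definition _ := GRing.Zmodule_isLmodule.Build R A_R
  rscaleA rscale1 rscaleDr rscaleDl.

Fact rscaleAl (a : R) (x y : A_R) : a *: (x * y) = a *: x * y.
Proof. exact: banach_scaleAl. Qed.
HB.instance Definition _ := GRing.Lmodule_isLalgebra.Build R A_R rscaleAl.
Fact rscaleAr (a : R) (x y : A_R) : a *: (x * y) = x * (a *: y).
Proof. exact: banach_scaleAr. Qed.
HB.instance Definition _ := GRing.Lalgebra_isAlgebra.Build R A_R rscaleAr.

Lemma rscaleE (r : R) (x : A) : r *: (x : A_R) = iota r *: x.
Proof. by []. Qed.

(** Norms in [K] are nonnegative, hence images of real numbers under [iota]. *)
Definition rnorm (x : A_R) : R := sval (cid (iota_surj (normr_ge0 (x : A)))).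

Lemma rnormE x : iota (rnorm x) = `|x : A|.
Proof. exact: svalP (cid (iota_surj (normr_ge0 (x : A)))). Qed.

Lemma rnorm_ge0 x : 0 <= rnorm x.
Proof. by rewrite -iota_mono rmorph0 rnormE. Qed.
Lemma rnormD x y : rnorm (x + y) <= rnorm x + rnorm y.
Proof. by rewrite -iota_mono rmorphD !rnormE ler_normD. Qed.
Lemma rnormM x y : rnorm (x * y) <= rnorm x * rnorm y.
Proof. by rewrite -iota_mono rmorphM !rnormE; exact: banach_norm_mul. Qed.
Lemma rnormZ r x : rnorm (r *: x) = `|r| * rnorm x.
Proof.
apply: (inc_inj iota_mono).
by rewrite rmorphM !rnormE rscaleE normrZ iota_norm.
Qed.

Lemma tendsP (u : nat -> A) (l : A) :
  tends rnorm (u : nat -> A_R) (l : A_R) <-> u @ \oo --> l.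
Proof.
split => [ul|/cvgrPdist_le ul e e0].
  apply/cvgrPdist_le => k k0; have [e ek] := iota_surj (ltW k0); subst k.
  have e0 : 0 < e by rewrite -(leW_mono iota_mono) rmorph0.
  have [M uM] := ul e e0; exists M => // n Mn /=.
  by rewrite -(rnormE (l - u n)) iota_mono; exact: uM.
have ie0 : 0 < iota e by rewrite -(rmorph0 iota) (leW_mono iota_mono).
have [M _ uM] := ul _ ie0; exists M => n Mn.
by rewrite -iota_mono rnormE; exact: uM.
Qed.

Lemma rtexpE N (x : A) :
  texp N (x : A_R) = series (fun k => (k`!%:R^-1 : K) *: x ^+ k : A) N.+1.
Proof.
rewrite seriesEord; apply: eq_bigr => k _.
by rewrite rscaleE fmorphV rmorph_nat.
Qed.

(** Completeness applies: the partial sums are Cauchy by comparison with [C] times the real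
    exponential series of [rnorm x]. *)
Lemma cvg_bexp (x : A) :
  series (fun k => (k`!%:R^-1 : K) *: x ^+ k : A) @ \oo --> bexp x.
Proof.
pose f (k : nat) : A := k`!%:R^-1 *: x ^+ k.
suff : cvgn (series f) by [].
apply: cauchy_cvg; apply: cauchy_exP => k k0.
have [e ek] := iota_surj (ltW k0); subst k.
have e0 : 0 < e by rewrite -(leW_mono iota_mono) rmorph0.
pose C := 1 + rnorm (1 : A_R).
have C0 : 0 < C by rewrite ltr_wpDr ?rnorm_ge0.
have /cvgrPdist_lt /(_ (e / (2 * C))) := @is_cvg_series_exp_coeff R (rnorm x).
rewrite divr_gt0 ?mulr_gt0// => /(_ isT)[M _ HM].
exists (series f M); exists M => // n /= Mn.
rewrite -ball_normE /ball_ /= -(rnormE (series f M - series f n)) (leW_mono iota_mono).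
rewrite (nmBC rnormZ) sub_series Mn.
have fle m : rnorm (f m) <= C * exp_coeff (rnorm x) m.
  have -> : f m = (m`!%:R^-1 : R) *: ((x : A_R) ^+ m).
    by rewrite rscaleE fmorphV rmorph_nat.
  rewrite rnormZ ger0_norm ?invr_ge0// /exp_coeff /= mulrA mulrC ler_wpM2r ?invr_ge0//.
  exact: (nmX rnorm_ge0 rnormM).
apply: (@le_lt_trans _ _ (C * (series (exp_coeff (rnorm x)) n - series (exp_coeff (rnorm x)) M))).
  rewrite sub_series Mn mulr_sumr; apply: le_trans (nm_sum rnormD rnormZ _ _ _) _.
  by apply: ler_sum => i _.
set l := limn _ in HM; have := HM _ Mn; have := HM M (leqnn M).
rewrite /= !ltr_norml -ltr_pdivlMl// => /andP[h1 h2] /andP[h3 h4].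
have -> : C^-1 * e = e / (2 * C) + e / (2 * C) by field; rewrite lt0r_neq0.
by lra.
Qed.

Lemma tends_texp (x : A) :
  tends rnorm (fun N => texp N (x : A_R)) (bexp x : A_R).
Proof.
rewrite (_ : (fun N => _) = (fun N => series (fun k => (k`!%:R^-1 : K) *: x ^+ k : A) N.+1)); last first.
  by apply/funext => N; exact: rtexpE.
apply/tendsP; have := @cvg_bexp x.
by rewrite -cvg_shiftS.
Qed.

Lemma bch_termE (x y : A) n : bch_term x y n = rbch_term (x : A_R) y n.
Proof.
rewrite /bch_term /rbch_term rscaleE fmorphV rmorph_nat; congr (_ *: _).
apply: eq_bigr => k _; rewrite rscaleE fmorph_div rmorphXn rmorphN1 rmorph_nat.
congr (_ *: _); apply: eq_bigr => f _.
by rewrite rscaleE fmorphV rmorph_nat.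
Qed.

Lemma mercator_termE (x y : A) n :
  mercator_term x y n = rmercator_term ((bexp x : A_R) * bexp y - 1) n.
Proof.
by rewrite /rmercator_term rscaleE fmorph_div rmorphXn rmorphN1 rmorph_nat.
Qed.

Lemma tends_unique (u : nat -> A_R) l m :
  tends rnorm u l -> tends rnorm u m -> l = m.
Proof. by move=> /tendsP + /tendsP; apply: cvg_unique. Qed.

Lemma tends_series (u : nat -> A) (l : A) : u 0%N = 0 ->
  series (fun n => u n.+1) @ \oo --> l ->
  tends rnorm (fun N => \sum_(n < N.+1) (u n : A_R)) l.
Proof.
move=> u0 ul; rewrite (_ : (fun N => _) = series (fun n => u n.+1)) ?tendsP//.
apply/funext => N; rewrite big_ord_recl u0 add0r seriesEord.
by apply: eq_bigr.
Qed.

(** The truncated exponentials of [V] tend both to e^V and, by Abel summation, to e^x e^y. *)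
Lemma bexp_bch (x y V : A) :
  bch_series x y @ \oo --> V -> bexp V = bexp x * bexp y.
Proof.
move=> xyV; apply: tends_unique (tends_texp V) _.
apply: (bch_texp rnorm_ge0 rnormD rnormM rnormZ (tends_texp x) (tends_texp y)).
have -> : (fun N => \sum_(n < N.+1) rbch_term (x : A_R) y n) =
    (fun N => \sum_(n < N.+1) (bch_term x y n : A_R)).
  by apply/funext => N; apply: eq_bigr => n _; rewrite bch_termE.
by apply: tends_series; rewrite // /bch_term invr0 scale0r.
Qed.

Lemma bexp_mercator (x y V : A) :
  mercator_series x y @ \oo --> V -> bexp V = bexp x * bexp y.
Proof.
move=> xyV; apply: tends_unique (tends_texp V) _.
have -> : (bexp x : A_R) * bexp y = 1 + ((bexp x : A_R) * bexp y - 1).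
  by rewrite addrC subrK.
apply: (mercator_texp rnorm_ge0 rnormD rnormM rnormZ).
have -> : (fun N => \sum_(n < N.+1) rmercator_term ((bexp x : A_R) * bexp y - 1) n) =
    (fun N => \sum_(n < N.+1) (mercator_term x y n : A_R)).
  by apply/funext => N; apply: eq_bigr => n _; rewrite mercator_termE.
by apply: tends_series; rewrite // /mercator_term invr0 mulr0 scale0r.
Qed.

Lemma bexp_comm (x : A) : x * bexp x = bexp x * x.
Proof.
have cst_tends (u : A_R) : tends rnorm (fun=> u) u.
  by move=> e e0; exists 0%N => n _; rewrite subrr (nm0 rnormZ) ltW.
have tM := tendsM rnorm_ge0 rnormD rnormM rnormZ.
apply: (tends_unique (tM _ _ _ _ (cst_tends x) (tends_texp x))).
have -> : (fun N => (x : A_R) * texp N (x : A_R)) = (fun N => texp N (x : A_R) * x).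
  apply/funext => N; rewrite mulr_sumr mulr_suml; apply: eq_bigr => k _.
  by rewrite -scalerAl -scalerAr -exprS exprSr.
exact: (tM _ _ _ _ (tends_texp x) (cst_tends x)).
Qed.

End Algebra.
End RestrictionOfScalars.

Lemma scalar_embedding (R : realType) (s : scalars) :
  exists iota : {rmorphism R -> scalar_field R s},
    {mono iota : x y / x <= y} /\
    (forall k : scalar_field R s, 0 <= k -> exists r, iota r = k).
Proof.
case: s; first by exists idfun; split => // k _; exists k.
exists (real_complex R : {rmorphism R -> R[i]}); split; first exact: lecR.
by move=> [a b]; rewrite lecE /= => /andP[/eqP -> _]; exists a.
Qed.

Lemma bexp_bch_sum (R : realType) (s : scalars)
    (A : banachAlgType (scalar_field R s)) (x y V : A) :
  bch_series x y @ \oo --> V -> bexp V = bexp x * bexp y.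
Proof.
have [iota [im isj]] := scalar_embedding R s.
(* In the zero algebra all elements are equal; otherwise the scalars can be restricted to [R]. *)
have [A0|nontriv] := eqVneq (1 : A) 0; last exact: (bexp_bch im isj nontriv).
by move=> _; rewrite -[LHS]mulr1 -[RHS]mulr1 A0 !mulr0.
Qed.

Lemma bexp_mercator_sum (R : realType) (s : scalars)
    (A : banachAlgType (scalar_field R s)) (x y V : A) :
  mercator_series x y @ \oo --> V -> bexp V = bexp x * bexp y.
Proof.
have [iota [im isj]] := scalar_embedding R s.
have [A0|nontriv] := eqVneq (1 : A) 0; last exact: (bexp_mercator im isj nontriv).
by move=> _; rewrite -[LHS]mulr1 -[RHS]mulr1 A0 !mulr0.
Qed.

(** * Subspaces that contain all BCH terms of degree at least two *)

Section BchTermsInIdeal.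
Context {K : numFieldType} {A : banachAlgType K}.
Variables (P : A -> Prop) (x y : A).
Hypothesis P0 : P 0.
Hypothesis PD : forall u v, P u -> P v -> P (u + v).
Hypothesis PZ : forall c u, P u -> P (c *: u).
Hypothesis Px : forall u, u = x \/ u = y \/ P u -> P (ad x u).
Hypothesis Py : forall u, u = x \/ u = y \/ P u -> P (ad y u).

Lemma iter_adx_ideal i u : P u -> P (iter i (ad x) u).
Proof. by move=> Pu; elim: i => //= i IH; apply: Px; right; right. Qed.
Lemma iter_ady_ideal i u : P u -> P (iter i (ad y) u).
Proof. by move=> Pu; elim: i => //= i IH; apply: Py; right; right. Qed.

Lemma iter_ad_ideal i j u : u = x \/ u = y \/ P u -> (i, j) != (0, 0)%N ->
  P (iter i (ad x) (iter j (ad y) u)).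
Proof.
move=> uP; case: j => [|j] ij; last first.
  apply: iter_adx_ideal; rewrite iterSr; apply: iter_ady_ideal; exact: Py.
case: i ij => [//|i] _ /=; rewrite -iterS iterSr.
by apply: iter_adx_ideal; exact: Px.
Qed.

Lemma lie_monomial_ideal (s : seq (nat * nat)) :
  all (predC1 (0, 0)%N) s -> (1 < degree s)%N -> P (lie_monomial x y s).
Proof.
rewrite /degree => + sd; have : s != [::] by case: s sd => //; rewrite big_nil.
move: sd.
(* The induction must also cover words of degree one, whose monomial is [x] or [y] and need not
   satisfy [P]. *)
have gen (t : seq (nat * nat)) : t != [::] -> all (predC1 (0, 0)%N) t ->
    let u := lie_monomial x y t in
    (u = x \/ u = y \/ P u) /\ ((1 < degree t)%N -> P u).
  elim: t => [//|[i j] [|p t] IH] _.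
    rewrite /degree big_seq1; case: j => [|j] /= /andP[ij _].
      case: i ij => [//|[|i]] _ /=; first by split => //; left.
      have Pu : P (ad x (iter i (ad x) x)).
        by rewrite -iterS iterSr; apply: iter_adx_ideal; apply: Px; left.
      by split => //; right; right.
    have [[-> ->]|ij0] := eqVneq (i, j) (0, 0)%N.
      by split => //; right; left.
    have Pu := iter_ad_ideal (or_intror (or_introl erefl)) ij0.
    by split => //; right; right.
  move=> /andP[ij pt]; have [uP _] := IH isT pt.
  have Pu := iter_ad_ideal uP ij.
  by split => //; right; right.
by move=> sd s0 sn; have [_] := gen s s0 sn; apply.
Qed.

(** A Lie monomial of degree at least two is a bracket with [x] or [y]. [P] will be the zero
    subspace for commuting elements, and the span of e and i e in the twisted algebra. *)
Lemma bch_term_ideal n : (1 < n)%N -> P (bch_term x y n).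
Proof.
move=> n1; apply: PZ; apply: big_ind => // k _; apply: PZ; apply: big_ind => // f.
move=> /andP[/forallP f0 /eqP fn]; apply: PZ; apply: lie_monomial_ideal.
  by apply/allP => p /mapP[r _ ->]; exact: f0.
by rewrite degree_ffun fn.
Qed.

End BchTermsInIdeal.

Lemma bscalerAl (K : numFieldType) (A : banachAlgType K) (c : K) (x y : A) :
  c *: (x * y) = c *: x * y.
Proof. exact: banach_scaleAl. Qed.

Lemma bscalerAr (K : numFieldType) (A : banachAlgType K) (c : K) (x y : A) :
  c *: (x * y) = x * (c *: y).
Proof. exact: banach_scaleAr. Qed.

Section RealBanachAlgebra.
Context {R : realType} {A : banachAlgType R}.
Implicit Types x y : A.

Lemma cvg_series_single (u : nat -> A) :
  (forall n, u n.+1 = 0) -> series u @ \oo --> u 0%N.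
Proof.
move=> u0; rewrite -cvg_shiftS /=.
rewrite (_ : (fun n => _) = cst (u 0%N)); first exact: cvg_cst.
by apply/funext => n; rewrite /series /= big_nat_recl//= big1_seq ?addr0.
Qed.

Lemma bexp_eq x l : series (fun k => (k`!%:R^-1 : R) *: x ^+ k : A) @ \oo --> l ->
  bexp x = l.
Proof. by move=> h; apply: cvg_lim h; exact: norm_hausdorff. Qed.

Lemma banach_exprZ (t : R) x n : (t *: x) ^+ n = t ^+ n *: x ^+ n.
Proof.
elim: n => [|n IH]; first by rewrite !expr0 scale1r.
by rewrite !exprS IH -bscalerAl -bscalerAr scalerA.
Qed.

(** The coefficients have the shape of [cos_coeff] and [sin_coeff], which makes Euler's formula a
    termwise identity of series. *)
Lemma sqrN1_exp (J : A) n : J * J = - 1 ->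
  J ^+ n = ((~~ odd n)%:R * (-1) ^+ n./2 : R) *: (1 : A) +
           ((odd n)%:R * (-1) ^+ n.-1./2 : R) *: J.
Proof.
move=> JJ; have JX m : J ^+ m.*2 = ((-1) ^+ m : R) *: (1 : A).
  elim: m => [|m IH]; first by rewrite !expr0 scale1r.
  rewrite doubleS (exprS J) (exprS J) mulrA JJ IH mulN1r.
  by rewrite exprS mulN1r scaleNr.
rewrite -{1}(odd_double_half n); have [n2|/negbTE n2] := boolP (odd n).
  rewrite /= mul0r scale0r add0r mul1r add1n exprSr JX -bscalerAl mul1r.
  by case: n n2 => //= n /negbTE n2; rewrite uphalf_half n2.
by rewrite /= mul0r scale0r addr0 mul1r add0n JX.
Qed.

Lemma bexp_cos_sin (J : A) (t : R) : J * J = - 1 ->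
  bexp (t *: J) = cos t *: (1 : A) + sin t *: J.
Proof.
move=> JJ; apply: bexp_eq.
rewrite [X in X @ _ --> _](_ : _ =
    (fun n => series (cos_coeff t) n *: (1 : A) + series (sin_coeff t) n *: J)).
  apply: cvgD; apply: cvgZr_tmp; rewrite unlock.
    exact: is_cvg_series_cos_coeff.
  exact: is_cvg_series_sin_coeff.
apply/funext => n; rewrite /series /= !scaler_suml -big_split; apply: eq_bigr => k _ /=.
rewrite banach_exprZ (sqrN1_exp _ JJ) !scalerDr !scalerA.
by congr (_ *: _ + _ *: _); rewrite /cos_coeff /sin_coeff /= -?exprnP; ring.
Qed.

Lemma bexp_scalar (r : R) : bexp (r *: (1 : A)) = expR r *: (1 : A).
Proof.
apply: bexp_eq.
rewrite [X in X @ _ --> _](_ : _ = (fun n => series (exp_coeff r) n *: (1 : A))).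
  by apply: cvgZr_tmp; exact: is_cvg_series_exp_coeff.
apply/funext => n; rewrite /series /= scaler_suml; apply: eq_bigr => k _ /=.
by rewrite banach_exprZ expr1n scalerA mulrC.
Qed.

Lemma bexp0 : bexp (0 : A) = 1.
Proof. by rewrite -(scale0r (1 : A)) bexp_scalar expR0 scale1r. Qed.

Lemma bexp_sqr0 y : y * y = 0 -> bexp y = 1 + y.
Proof.
move=> yy; apply: bexp_eq.
set u := (fun k => _).
have -> : series u = (fun n => series (fun k => if k is 0%N then 1 else 0) n +
    series (fun k => if k is 1%N then y else 0) n).
  apply/funext => n; rewrite /series /= -big_split; apply: eq_bigr => -[|[|k]] _ /=.
  - by rewrite /u invr1 scale1r addr0.
  - by rewrite /u invr1 scale1r add0r expr1.
  - by rewrite /u exprS exprS mulrA yy mul0r scaler0 addr0.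
apply: cvgD; first exact: (@cvg_series_single (fun k => if k is 0%N then 1 else 0)).
rewrite -cvg_shiftS.
rewrite [X in X @ _ --> _](_ : _ = series (fun k => if k is 0%N then y else 0)).
  exact: (@cvg_series_single (fun k => if k is 0%N then y else 0)).
by apply/funext => n; rewrite /series /= big_nat_recl// add0r.
Qed.

End RealBanachAlgebra.

(** * The counterexamples *)

Section TwistedAlgebra.
Context {R : realType}.

Definition twisted : Type := 'rV[R]_4.
HB.instance Definition _ := NormedModule.copy twisted 'rV[R]_4.
HB.instance Definition _ := Complete.copy twisted 'rV[R]_4.

Definition mk (a b c d : R) : twisted := \row_i [:: a; b; c; d]`_i.

Definition c0 (v : twisted) : R := v 0 (@Ordinal 4 0 isT).
Definition c1 (v : twisted) : R := v 0 (@Ordinal 4 1 isT).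
Definition c2 (v : twisted) : R := v 0 (@Ordinal 4 2 isT).
Definition c3 (v : twisted) : R := v 0 (@Ordinal 4 3 isT).

Lemma twistedP (u v : twisted) :
  c0 u = c0 v -> c1 u = c1 v -> c2 u = c2 v -> c3 u = c3 v -> u = v.
Proof.
move=> e0 e1 e2 e3; apply/rowP => -[[|[|[|[|//]]]] i4].
- by rewrite (_ : Ordinal i4 = @Ordinal 4 0 isT)//; apply/val_inj.
- by rewrite (_ : Ordinal i4 = @Ordinal 4 1 isT)//; apply/val_inj.
- by rewrite (_ : Ordinal i4 = @Ordinal 4 2 isT)//; apply/val_inj.
- by rewrite (_ : Ordinal i4 = @Ordinal 4 3 isT)//; apply/val_inj.
Qed.

Lemma c0_mk a b c d : c0 (mk a b c d) = a. Proof. by rewrite /c0 mxE. Qed.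
Lemma c1_mk a b c d : c1 (mk a b c d) = b. Proof. by rewrite /c1 mxE. Qed.
Lemma c2_mk a b c d : c2 (mk a b c d) = c. Proof. by rewrite /c2 mxE. Qed.
Lemma c3_mk a b c d : c3 (mk a b c d) = d. Proof. by rewrite /c3 mxE. Qed.
Definition c_mk := (c0_mk, c1_mk, c2_mk, c3_mk).

Lemma c0D u v : c0 (u + v) = c0 u + c0 v. Proof. by rewrite /c0 mxE. Qed.
Lemma c1D u v : c1 (u + v) = c1 u + c1 v. Proof. by rewrite /c1 mxE. Qed.
Lemma c2D u v : c2 (u + v) = c2 u + c2 v. Proof. by rewrite /c2 mxE. Qed.
Lemma c3D u v : c3 (u + v) = c3 u + c3 v. Proof. by rewrite /c3 mxE. Qed.
Lemma c0Z a v : c0 (a *: v) = a * c0 v. Proof. by rewrite /c0 mxE. Qed.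
Lemma c1Z a v : c1 (a *: v) = a * c1 v. Proof. by rewrite /c1 mxE. Qed.
Lemma c2Z a v : c2 (a *: v) = a * c2 v. Proof. by rewrite /c2 mxE. Qed.
Lemma c3Z a v : c3 (a *: v) = a * c3 v. Proof. by rewrite /c3 mxE. Qed.
Lemma c0N v : c0 (- v) = - c0 v. Proof. by rewrite /c0 mxE. Qed.
Lemma c1N v : c1 (- v) = - c1 v. Proof. by rewrite /c1 mxE. Qed.
Lemma c2N v : c2 (- v) = - c2 v. Proof. by rewrite /c2 mxE. Qed.
Lemma c3N v : c3 (- v) = - c3 v. Proof. by rewrite /c3 mxE. Qed.
Lemma c0_0 : c0 0 = 0. Proof. by rewrite /c0 mxE. Qed.
Lemma c1_0 : c1 0 = 0. Proof. by rewrite /c1 mxE. Qed.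
Lemma c2_0 : c2 0 = 0. Proof. by rewrite /c2 mxE. Qed.
Lemma c3_0 : c3 0 = 0. Proof. by rewrite /c3 mxE. Qed.
Definition c_lin := (c0D, c1D, c2D, c3D, c0Z, c1Z, c2Z, c3Z, c0N, c1N, c2N, c3N,
  c0_0, c1_0, c2_0, c3_0).

Definition tw_one : twisted := mk 4 0 0 0.

(* [mk a b c d] stands for ((a + b i) + (c + d i) e) / 4 where e e = 0 and
   z e = e z^* for z complex. The factor 4 makes the sup norm submultiplicative. *)
Definition tw_mul (u v : twisted) : twisted := 4^-1 *: mk
  (c0 u * c0 v - c1 u * c1 v)
  (c0 u * c1 v + c1 u * c0 v)
  (c0 u * c2 v - c1 u * c3 v + c2 u * c0 v + c3 u * c1 v)
  (c0 u * c3 v + c1 u * c2 v + c3 u * c0 v - c2 u * c1 v).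

Lemma c0M u v : c0 (tw_mul u v) = 4^-1 * (c0 u * c0 v - c1 u * c1 v).
Proof. by rewrite c0Z c0_mk. Qed.
Lemma c1M u v : c1 (tw_mul u v) = 4^-1 * (c0 u * c1 v + c1 u * c0 v).
Proof. by rewrite c1Z c1_mk. Qed.
Lemma c2M u v : c2 (tw_mul u v) =
  4^-1 * (c0 u * c2 v - c1 u * c3 v + c2 u * c0 v + c3 u * c1 v).
Proof. by rewrite c2Z c2_mk. Qed.
Lemma c3M u v : c3 (tw_mul u v) =
  4^-1 * (c0 u * c3 v + c1 u * c2 v + c3 u * c0 v - c2 u * c1 v).
Proof. by rewrite c3Z c3_mk. Qed.
Definition c_mul := (c0M, c1M, c2M, c3M).

Fact tw_mulA : associative tw_mul.
Proof. by move=> u v w; apply: twistedP; rewrite !c_mul; field. Qed.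
Fact tw_mul1l : left_id tw_one tw_mul.
Proof. by move=> u; apply: twistedP; rewrite !c_mul !c_mk; field. Qed.
Fact tw_mul1r : right_id tw_one tw_mul.
Proof. by move=> u; apply: twistedP; rewrite !c_mul !c_mk; field. Qed.
Fact tw_mulDl : left_distributive tw_mul +%R.
Proof. by move=> u v w; apply: twistedP; rewrite !(c_mul, c_lin); ring. Qed.
Fact tw_mulDr : right_distributive tw_mul +%R.
Proof. by move=> u v w; apply: twistedP; rewrite !(c_mul, c_lin); ring. Qed.
Fact tw_scaleAl (a : R) (x y : twisted) : a *: tw_mul x y = tw_mul (a *: x) y.
Proof. by apply: twistedP; rewrite !(c_mul, c_lin); ring. Qed.
Fact tw_scaleAr (a : R) (x y : twisted) : a *: tw_mul x y = tw_mul x (a *: y).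
Proof. by apply: twistedP; rewrite !(c_mul, c_lin); ring. Qed.

Lemma tw_normE (v : twisted) : `|v| = \big[Num.max/0]_ij `|v ij.1 ij.2|.
Proof. exact: mx_normrE. Qed.

Lemma tw_coord_le (v : twisted) i : `|v 0 i| <= `|v|.
Proof.
rewrite tw_normE; apply/bigmax_geP; right.
by exists (0, i).
Qed.

Lemma tw_norm_le (v : twisted) (M : R) : 0 <= M ->
  `|c0 v| <= M -> `|c1 v| <= M -> `|c2 v| <= M -> `|c3 v| <= M -> `|v| <= M.
Proof.
move=> M0 h0 h1 h2 h3; rewrite tw_normE.
apply/bigmax_leP; split => // -[i [[|[|[|[|//]]]] i4]] _; rewrite ord1 /=.
- by rewrite (_ : Ordinal i4 = @Ordinal 4 0 isT)//; apply/val_inj.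
- by rewrite (_ : Ordinal i4 = @Ordinal 4 1 isT)//; apply/val_inj.
- by rewrite (_ : Ordinal i4 = @Ordinal 4 2 isT)//; apply/val_inj.
- by rewrite (_ : Ordinal i4 = @Ordinal 4 3 isT)//; apply/val_inj.
Qed.

(** After padding with zeros, each coordinate of the product is the mean of four signed products of
    coordinates, each bounded by the product of the norms. *)
Fact tw_norm_mul (x y : twisted) : `|tw_mul x y| <= `|x| * `|y|.
Proof.
have B i j : `|x 0 i * y 0 j| <= `|x| * `|y| by rewrite normrM ler_pM// tw_coord_le.
have B' i j : - (`|x| * `|y|) <= x 0 i * y 0 j <= `|x| * `|y| by rewrite -ler_norml B.
have sum4 (p q r s M : R) : - M <= p <= M -> - M <= q <= M -> - M <= r <= M ->
    - M <= s <= M -> `|4^-1 * (p + q + r + s)| <= M.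
  move=> /andP[? ?] /andP[? ?] /andP[? ?] /andP[? ?].
  by rewrite ler_norml; apply/andP; split; lra.
have N i j : - (`|x| * `|y|) <= - (x 0 i * y 0 j) <= `|x| * `|y|.
  by have := B' i j; rewrite lerN2 lerNl andbC.
have Z : - (`|x| * `|y|) <= 0 <= `|x| * `|y| by rewrite oppr_le0 andbb mulr_ge0.
apply: tw_norm_le; first by rewrite mulr_ge0.
- rewrite c0M -[_ - _]addr0 -[_ + 0]addr0; apply: sum4; (exact: Z || exact: N || exact: B').
- rewrite c1M -[_ * _ + _]addr0 -[_ + 0]addr0; apply: sum4; (exact: Z || exact: N || exact: B').
- rewrite c2M; apply: sum4; (exact: Z || exact: N || exact: B').
- rewrite c3M; apply: sum4; (exact: Z || exact: N || exact: B').
Qed.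

Definition twisted_alg : banachAlgType R := @BanachAlgebra R twisted tw_one tw_mul
  tw_mulA tw_mul1l tw_mul1r tw_mulDl tw_mulDr tw_scaleAl tw_scaleAr tw_norm_mul.

End TwistedAlgebra.

Lemma bch_term1 (R : realType) (A : banachAlgType R) (x y : A) :
  (1 : A) != 0 -> bch_term x y 1 = x + y.
Proof.
move=> nontriv.
by rewrite (bch_termE (idfun : {rmorphism R -> R}) nontriv) rbch_term1.
Qed.

(** All brackets vanish, so the series stops after its first term. *)
Lemma cvg_bch_comm (R : realType) (A : banachAlgType R) (x y : A) :
  (1 : A) != 0 -> x * y = y * x -> bch_series x y @ \oo --> x + y.
Proof.
move=> nontriv xy; rewrite -(bch_term1 x y nontriv).
apply: (@cvg_series_single _ _ (fun n => bch_term x y n.+1)) => n.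
apply: (@bch_term_ideal _ _ (fun v => v = 0)) => //.
- by move=> u v -> ->; rewrite addr0.
- by move=> c u ->; rewrite scaler0.
- by move=> u [->|[->|->]]; rewrite /ad ?xy ?mulr0 ?mul0r subrr.
- by move=> u [->|[->|->]]; rewrite /ad ?xy ?mulr0 ?mul0r subrr.
Qed.

(** * Behaviour of the two series and of logarithms in the twisted algebra *)

Section Examples.
Context {R : realType}.
Local Notation T := (twisted_alg : banachAlgType R).
Implicit Types u v : T.

Let im : T := mk 0 4 0 0.
Let eps : T := mk 0 0 4 0.

Lemma tw_oneE : (1 : T) = mk 4 0 0 0. Proof. by []. Qed.
Lemma tw_mulE u v : u * v = tw_mul u v. Proof. by []. Qed.

Lemma tw_one_neq0 : (1 : T) != 0.
Proof.
apply/eqP => /(congr1 c0); rewrite tw_oneE c0_mk c0_0 => /eqP.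
by rewrite pnatr_eq0.
Qed.

Lemma im_sqr : im * im = - 1.
Proof.
by apply: twistedP; rewrite tw_mulE tw_oneE !(c_mul, c_lin) !c_mk; field.
Qed.

Lemma eps_sqr : eps * eps = 0.
Proof.
by apply: twistedP; rewrite tw_mulE !(c_mul, c_lin) !c_mk; field.
Qed.

Lemma eps_neq0 : eps != 0.
Proof. by apply/eqP => /(congr1 c2); rewrite c2_mk c2_0 => /eqP; rewrite pnatr_eq0. Qed.

Lemma bexp_eps : bexp eps = 1 + eps.
Proof. exact: bexp_sqr0 eps_sqr. Qed.

Lemma bexp_2pi (J : T) : J * J = - 1 -> bexp ((pi *+ 2) *: J) = 1.
Proof. by move=> JJ; rewrite bexp_cos_sin// cos2pi sin2pi scale1r scale0r addr0. Qed.

Lemma bexp_pi (J : T) : J * J = - 1 -> bexp (pi *: J) = - 1.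
Proof. by move=> JJ; rewrite bexp_cos_sin// cospi sinpi scaleN1r scale0r addr0. Qed.

Lemma cvg_coord (u : nat -> T) (l : T) i : u @ \oo --> l ->
  (fun n => (u n : twisted) 0 i) @ \oo --> (l : twisted) 0 i.
Proof.
move=> /cvgrPdist_le ul; apply/cvgrPdist_le => e e0.
have [M _ uM] := ul e e0; exists M => // n Mn /=.
have := uM n Mn; apply: le_trans.
have -> : (l : twisted) 0 i - (u n : twisted) 0 i = ((l - u n : T) : twisted) 0 i.
  by rewrite !mxE.
exact: (tw_coord_le (l - u n : T)).
Qed.

Lemma sum_coord (I : Type) (r : seq I) (F : I -> T) i :
  ((\sum_(k <- r) F k : T) : twisted) 0 i = \sum_(k <- r) (F k : twisted) 0 i.
Proof. exact: (@summxE R 1 4). Qed.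

(** Here e^x e^y - 1 is [eps], of square zero: only the first term survives. *)
Lemma mercator_eps : mercator_converges ((pi *+ 2) *: im) eps.
Proof.
rewrite /mercator_converges /mercator_series.
apply/cvg_ex; eexists; apply: cvg_series_single => n.
rewrite /mercator_term bexp_2pi ?im_sqr// bexp_eps mul1r addrC addKr.
by rewrite (exprS eps) (exprS eps) mulrA eps_sqr mul0r scaler0.
Qed.

Lemma bch_eps_diverges : ~ bch_converges ((pi *+ 2) *: im) eps.
Proof.
move=> xyV; set x : T := (pi *+ 2) *: im in xyV *.
set V := limn (bch_series x eps) in xyV.
have VE : bexp V = bexp x * bexp eps := @bexp_bch_sum R RealScalars T x eps V xyV.
(* The complex parts commute, so every bracket has complex part zero; the sum [V] has that of
   [x + eps]. *)
have termE n : c0 (bch_term x eps n.+2) = 0 /\ c1 (bch_term x eps n.+2) = 0.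
  apply: (@bch_term_ideal _ _ (fun v : T => c0 v = 0 /\ c1 v = 0)) => //.
  - by rewrite c0_0 c1_0.
  - by move=> u v [u0 u1] [v0 v1]; rewrite c0D c1D u0 u1 v0 v1 addr0.
  - by move=> c u [u0 u1]; rewrite c0Z c1Z u0 u1 mulr0.
  - by move=> u _; rewrite /ad !tw_mulE !(c_lin, c_mul); split; ring.
  - by move=> u _; rewrite /ad !tw_mulE !(c_lin, c_mul); split; ring.
have VC (i : 'I_4) : (forall n, (bch_term x eps n.+2 : twisted) 0 i = 0) ->
    (V : twisted) 0 i = ((x + eps : T) : twisted) 0 i.
  move=> ti; apply: (cvg_unique _ (@cvg_coord _ _ i xyV)) => //.
  apply: cvg_near_cst; exists 1%N => // -[//|n] _ /=.
  rewrite /bch_series /series /= sum_coord big_nat_recl// big1 => [|k _]; last exact: ti.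
  by rewrite addr0 (bch_term1 _ _ tw_one_neq0).
have V0 : c0 V = 0.
  by rewrite [LHS](VC _ (fun n => (termE n).1)) -/(c0 _) !c_lin !c_mk mulr0 addr0.
have V1 : c1 V = pi *+ 2 * 4.
  by rewrite [LHS](VC _ (fun n => (termE n).2)) -/(c1 _) !c_lin !c_mk addr0.
have p0 : (pi *+ 2 : R) != 0 by rewrite mulrn_eq0 /= gt_eqF// pi_gt0.
(* An element of complex part [i] squares to [-1] whatever its component along e, since e
   anticommutes with i. Euler's formula thus applies to V / (2 pi). *)
have : bexp V = 1.
  rewrite -(bexp_2pi (J := (pi *+ 2)^-1 *: V)) ?scalerA ?divff ?scale1r//.
  apply: twistedP; rewrite tw_mulE tw_oneE !(c_mul, c_lin) !c_mk V0 V1;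
    move: (pi *+ 2 : R) p0 => p p0; field => //.
move/eqP; rewrite VE bexp_2pi ?im_sqr// bexp_eps mul1r -subr_eq0 addrC addKr.
by apply/negP; exact: eps_neq0.
Qed.

Lemma no_log_eps : ~ product_has_log (pi *: im) eps.
Proof.
move=> [V]; rewrite bexp_pi ?im_sqr// bexp_eps mulN1r => VE.
have Vc : V * bexp V = bexp V * V.
  have [iota [imono isurj]] := scalar_embedding R RealScalars.
  exact: (bexp_comm imono isurj tw_one_neq0).
(* Commuting with - (1 + e) means commuting with e, which forces a real complex part. *)
have V1 : c1 V = 0.
  have := congr1 c3 Vc; rewrite VE !tw_mulE !c_mul !c_lin !c_mk; lra.
(* On powers of [V] the real part [c0 / 4] is now multiplicative, so that of e^V is a real
   exponential, hence positive, against [-1] for - (1 + e). *)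
have powV n : c1 (V ^+ n) = 0 /\ c0 (V ^+ n) = 4 * (c0 V / 4) ^+ n.
  elim: n => [|n [IH1 IH0]]; first by rewrite !expr0 tw_oneE !c_mk mulr1.
  by rewrite !exprS tw_mulE !c_mul IH1 IH0 V1; split; field.
pose i0 : 'I_4 := @Ordinal 4 0 isT.
pose f (k : nat) : T := (k`!%:R^-1 : R) *: V ^+ k.
have h0 : (fun n => (series f n : twisted) 0 i0) @ \oo --> (bexp V : twisted) 0 i0.
  apply: cvg_coord.
  exact: (@cvg_bexp R R idfun (fun _ _ => erefl) (fun k _ => ex_intro _ k erefl) T
    tw_one_neq0 V).
have h1 : (fun n => 4 * series (exp_coeff (c0 V / 4)) n) @ \oo --> 4 * expR (c0 V / 4).
  by apply: cvgMr; exact: is_cvg_series_exp_coeff.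
have fE : (fun n => (series f n : twisted) 0 i0) =
    (fun n => 4 * series (exp_coeff (c0 V / 4)) n).
  apply/funext => n; rewrite /series /= sum_coord mulr_sumr; apply: eq_bigr => k _.
  by rewrite -/(c0 _) c0Z (powV k).2 mulrCA [_^-1 * _]mulrC.
rewrite fE in h0.
have : c0 (bexp V) = 4 * expR (c0 V / 4) by exact: (cvg_unique _ h0 h1).
rewrite VE !c_lin !c_mk => e1; have := expR_gt0 (c0 V / 4); lra.
Qed.

Lemma mercator_scalar_diverges : ~ mercator_converges (2 *: (1 : T)) 0.
Proof.
move=> /cvg_series_cvg_0 /cvgrPdist_lt /(_ `|1 : T|).
rewrite normr_gt0 tw_one_neq0 => /(_ isT)[M _ HM].
have : `|0 - mercator_term (2 *: (1 : T)) 0 M.+1| < `|1 : T| := HM M (leqnn M).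
rewrite sub0r normrN /mercator_term bexp_scalar bexp0 mulr1.
rewrite -[X in _ - X]scale1r -scalerBl banach_exprZ expr1n scalerA normrZ.
rewrite -[ltRHS]mul1r ltr_pM2r ?normr_gt0 ?tw_one_neq0//.
apply/negP; rewrite -leNgt (normrM _ (_ ^+ M.+1)) (normrM _ (_^-1)) normfV !normrX normrN1.
rewrite expr1n mul1r.
(* The [n]-th term has norm at least 2^n / n times that of [1], so the terms do not tend to [0]. *)
have e2 : 2 <= expR 2 - 1 :> R.
  by have := expR_ge1Dx (2 : R); lra.
rewrite !ger0_norm ?(le_trans _ e2)// mulrC ler_pdivlMr ?ltr0n// mul1r.
apply: (@le_trans _ _ (2 ^+ M.+1)).
  by rewrite -natrX ler_nat ltnW// ltn_expl.
have e0 := le_trans (ler0n R 2) e2.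
by rewrite lerXn2r ?nnegrE.
Qed.

End Examples.

Theorem proposition2p4 (R : realType) :
  (* 1 *)
  ((forall (s : scalars) (A : banachAlgType (scalar_field R s)) (x y : A),
      bch_converges x y -> product_has_log x y) /\
   (exists (s : scalars) (A : banachAlgType (scalar_field R s)) (x y : A),
      product_has_log x y /\ ~ bch_converges x y)) /\
  (* 2 *)
  ((forall (s : scalars) (A : banachAlgType (scalar_field R s)) (x y : A),
      mercator_converges x y -> product_has_log x y) /\
   (exists (s : scalars) (A : banachAlgType (scalar_field R s)) (x y : A),
      product_has_log x y /\ ~ mercator_converges x y)) /\
  (* 3 *)
  ((exists (s : scalars) (A : banachAlgType (scalar_field R s)) (x y : A),
      mercator_converges x y /\ ~ bch_converges x y) /\
   (exists (s : scalars) (A : banachAlgType (scalar_field R s)) (x y : A),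
      bch_converges x y /\ ~ mercator_converges x y)) /\
  (* 4 *)
  (exists (s : scalars) (A : banachAlgType (scalar_field R s)) (x y : A),
      [/\ ~ mercator_converges x y, ~ bch_converges x y &
          ~ product_has_log x y]) /\
  (* 5 *)
  (exists (s : scalars) (A : banachAlgType (scalar_field R s)) (x y : A),
      [/\ mercator_converges x y, bch_converges x y & ~ equal_sums x y]).
Proof.
have bch_log s (A : banachAlgType (scalar_field R s)) (x y : A) :
    bch_converges x y -> product_has_log x y.
  by move=> xyV; exists (limn (bch_series x y)); exact: bexp_bch_sum.
have mercator_log s (A : banachAlgType (scalar_field R s)) (x y : A) :
    mercator_converges x y -> product_has_log x y.
  by move=> xyV; exists (limn (mercator_series x y)); exact: bexp_mercator_sum.
pose T : banachAlgType R := twisted_alg.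
pose im : T := mk 0 4 0 0; pose eps : T := mk 0 0 4 0.
have nontriv : (1 : T) != 0 := tw_one_neq0.
have cvg0 (x : T) : bch_series x 0 @ \oo --> x.
  by rewrite -{2}[x]addr0; apply: cvg_bch_comm; rewrite // mul0r mulr0.
have mer0 (n : nat) : mercator_term ((pi *+ 2) *: im) (0 : T) n.+1 = 0.
  rewrite /mercator_term bexp_2pi ?im_sqr// bexp0 mulr1 subrr (exprS 0) mul0r.
  by rewrite scaler0.
have cvgm0 : mercator_series ((pi *+ 2) *: im) (0 : T) @ \oo --> (0 : T).
  have := @cvg_series_single _ T
    (fun n => mercator_term ((pi *+ 2) *: im) (0 : T) n.+1) (fun n => mer0 n.+1).
  by rewrite mer0.
split; [split=> //|split; [split=> //|split; [split|split]]].
(* The logarithm is provided by the convergent Mercator series. *)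
- exists RealScalars, T, ((pi *+ 2) *: im), eps.
  split; [exact: (mercator_log RealScalars T _ _ mercator_eps)|exact: bch_eps_diverges].
- exists RealScalars, T, (2 *: (1 : T)), 0.
  by split; [exists (2 *: (1 : T)); rewrite bexp0 mulr1|exact: mercator_scalar_diverges].
- exists RealScalars, T, ((pi *+ 2) *: im), eps.
  by split; [exact: mercator_eps|exact: bch_eps_diverges].
- exists RealScalars, T, (2 *: (1 : T)), 0.
  by split; [apply/cvg_ex; eexists; exact: cvg0|exact: mercator_scalar_diverges].
(* Convergence of either series would yield a logarithm, and there is none. *)
- exists RealScalars, T, (pi *: im), eps; split; last exact: no_log_eps.
    by move=> /(mercator_log RealScalars T); exact: no_log_eps.
  by move=> /(bch_log RealScalars T); exact: no_log_eps.
- exists RealScalars, T, ((pi *+ 2) *: im), 0.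
  split; [by apply/cvg_ex; eexists; exact: cvgm0|by apply/cvg_ex; eexists; exact: cvg0|].
  rewrite /equal_sums (cvg_lim _ (cvg0 _)) ?(cvg_lim _ cvgm0)//; try exact: norm_hausdorff.
  (* The sums [0] and 2 pi i differ in the coordinate [c1]. *)
  move=> /(congr1 (fun v : T => c1 v)); rewrite c1_0 c1Z c1_mk => /esym/eqP.
  by rewrite mulf_eq0 mulrn_eq0 /= !gt_eqF// pi_gt0.
Qed.
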